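(* Let $X$ be a topological space. Then $\mathbf V_bX$ is the free cone over the barycentric algebra $\mathbf V_1X$, and $\mathbf V_bX$ is the free semitopological cone over the semitopological barycentric algebra $\mathbf V_1X$. That is: for every cone $\mathfrak C$, every affine map $f\colon\mathbf V_1X\to\mathfrak C$ extends to a unique linear map $\hat f\colon\mathbf V_bX\to\mathfrak C$; and if $\mathfrak C$ is a semitopological cone and $f$ is continuous, then $\hat f$ is continuous. As a consequence, $\mathbf V_bX$ and $\mathrm{cone}(\mathbf V_1X)$ (with its cone topology) are naturally isomorphic semitopological cones. Similarly, $\mathbf V_{b,\mathrm p}X$ is the free semitopological cone over the semitopological barycentric algebra $\mathbf V_{1,\mathrm p}X$: for every semitopological cone $\mathfrak C$, every affine continuous map $\mathbf V_{1,\mathrm p}X\to\mathfrak C$ extends to a unique linear continuous map $\mathbf V_{b,\mathrm p}X\to\mathfrak C$.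
   Context: $\mathbb R_+=[0,\infty[$ and $\overline{\mathbb R}_+=\mathbb R_+\cup\{\infty\}$ carry the Scott topology of the usual order (open sets $\{t:t>a\}$, the whole set, $\emptyset$). A continuous valuation on $X$ is a map $\nu$ from the lattice $\mathcal O X$ of open subsets of $X$ to $\overline{\mathbb R}_+$ with $\nu(\emptyset)=0$, $\nu(U)+\nu(V)=\nu(U\cup V)+\nu(U\cap V)$, and Scott-continuous (monotone and preserving directed suprema). $\mathbf VX$ is the set of all of them with the weak topology, generated by the sets $[U>r]=\{\nu:\nu(U)>r\}$, $U\in\mathcal OX$, $r>0$, and with pointwise addition and scalar multiplication. $\mathbf V_bX$ and $\mathbf V_1X$ are the subspaces of those $\nu$ with $\nu(X)<\infty$, resp. $\nu(X)=1$. A point-continuous valuation is a map $\nu\colon \mathcal OX\to\overline{\mathbb R}_+$ that is strict ($\nu(\emptyset)=0$), modular, and continuous when $\mathcal OX$ has the topology generated by the sets $\{U\in\mathcal OX: x\in U\}$, $x\in X$ (every such map is a continuous valuation). $\mathbf V_{b,\mathrm p}X$ and $\mathbf V_{1,\mathrm p}X$ are the subspaces of $\mathbf V_bX$ and $\mathbf V_1X$ of point-continuous valuations. A cone is a commutative monoid $(\mathfrak C,+,0)$ with an action of $\mathbb R_+$ satisfying $0\cdot x=0$, $(ab)\cdot x=a\cdot(b\cdot x)$, $1\cdot x=x$, $a\cdot0=0$, $a\cdot(x+y)=a\cdot x+a\cdot y$, $(a+b)\cdot x=a\cdot x+b\cdot x$. It is semitopological if it has a topology making $+$ and $\cdot$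 separately continuous ($\mathbb R_+$ with the Scott topology). A linear map is additive and satisfies $f(a\cdot x)=a\cdot f(x)$ for all $a\in\mathbb R_+$. A barycentric algebra is a set with operations $+_a$, $a\in[0,1]$, such that $x+_1y=x$, $x+_ax=x$, $x+_ay=y+_{1-a}x$, $(x+_ay)+_bz=x+_{ab}(y+_{\frac{(1-a)b}{1-ab}}z)$ if $a,b<1$; it is semitopological if it has a topology making $(x,a,y)\mapsto x+_ay$ separately continuous, $[0,1]$ having its metric topology. Convex subsets of cones (such as $\mathbf V_1X$) are barycentric algebras with $x+_ay=a\cdot x+(1-a)\cdot y$. A map is affine if it commutes with every $+_a$. For a semitopological barycentric algebra $\mathcal B$ (preordered by its specialization preordering: $x\le y$ iff every open neighborhood of $x$ contains $y$), $\mathrm{cone}(\mathcal B)$ is the set of pairs $(r,x)$, $r>0$, $x\in\mathcal B$, plus an element $0$, with $a\cdot(r,x)=(ar,x)$ for $a>0$, $0\cdot u=0$, $a\cdot 0=0$, $(r,x)+(s,y)=(r+s,x+_{\frac r{r+s}}y)$, $0$ neutral. Let $u\le^{\mathrm{cone}}v$ iff $u=v=0$, or $v=(s,y)$ and there are $u'\in\mathrm{cone}(\mathcal B)$, $y_1\in\mathcal B$ with $u+u'=(s,y_1)$ and $y_1\le y$. The cone topology on $\mathrm{cone}(\mathcal B)$ has as subbase the open subsets of $(\mathbb R_+\setminus\{0\})\times\mathcal B$ (product topology, Scott topology on the first factor) that are upwards-closed in $\mathrm{cone}(\mathcal B)$ for $\le^{\mathrm{cone}}$. *)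

(* Defs.v *)
From HB Require Import structures.
From mathcomp Require Import all_boot all_order all_algebra finmap.
From mathcomp Require Import all_classical all_reals topology.
From mathcomp Require Import interval_inference ereal convex.
Set Implicit Arguments.
Unset Strict Implicit.
Unset Printing Implicit Defensive.
Import Order.TTheory GRing.Theory Num.Theory.

Local Open Scope classical_set_scope.
Local Open Scope ring_scope.

(* For T = {nonneg R}, {posnum R} or \bar R the nonempty proper open sets are
   exactly the rays [set t | a < t]. *)
Definition scott {d} (T : orderType d) : Type := T.

Section Scott.
Context {d} (T : orderType d).
HB.instance Definition _ := Choice.on (scott T).
Definition scott_rays : set (set (scott T)) :=
  range (fun a : T => [set t : T | (a < t)%O]).
HB.instance Definition _ :=
  isSubBaseTopological.Build (scott T) scott_rays idfun.
End Scott.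

Lemma scott_continuousP {d} (T : topologicalType) (S : orderType d) (f : T -> scott S) :
  continuous f <-> forall a : S, open [set t | (a < (f t : S))%O].
Proof.
split=> [/continuousP cf a|of_].
  apply: (cf [set t : S | (a < t)%O]).
  exists [set [set t : S | (a < t)%O]]; last by rewrite bigcup_set1.
  move=> _ ->.
  exists [fset [set t : S | (a < t)%O]]%fset; last by rewrite set_fset1 bigcap_set1.
  by move=> A /fset1P ->; rewrite inE; exists a.
apply/continuousP => _ [B BfinI <-].
rewrite preimage_bigcup; apply: bigcup_open => A /BfinI [F FD <-].
rewrite preimage_bigcap bigcap_fset big_seq.
apply: (big_ind (@open T)); [exact: openT|exact: openI|move=> C /FD].
by rewrite inE => -[a _ <-]; exact: of_.
Qed.

Section NonnegSemiRing.
Variable R : realDomainType.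
Implicit Types a b c : {nonneg R}.

Let add a b : {nonneg R} := (a%:num + b%:num)%:nng.
Let mul a b : {nonneg R} := (a%:num * b%:num)%:nng.
Let zero : {nonneg R} := 0%:nng.
Let one : {nonneg R} := 1%:nng.

Let addA : associative add.
Proof. by move=> a b c; apply/val_inj; rewrite /= addrA. Qed.
Let addC : commutative add.
Proof. by move=> a b; apply/val_inj; rewrite /= addrC. Qed.
Let add0 : left_id zero add.
Proof. by move=> a; apply/val_inj; rewrite /= add0r. Qed.
Let mulA : associative mul.
Proof. by move=> a b c; apply/val_inj; rewrite /= mulrA. Qed.
Let mulC : commutative mul.
Proof. by move=> a b; apply/val_inj; rewrite /= mulrC. Qed.
Let mul1 : left_id one mul.
Proof. by move=> a; apply/val_inj; rewrite /= mul1r. Qed.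
Let mulDl : left_distributive mul add.
Proof. by move=> a b c; apply/val_inj; rewrite /= mulrDl. Qed.
Let mul0 : left_zero zero mul.
Proof. by move=> a; apply/val_inj; rewrite /= mul0r. Qed.
Let oneN0 : one != zero.
Proof. by apply/eqP => /(congr1 val)/=; apply/eqP/oner_neq0. Qed.

HB.instance Definition _ := Choice.on {nonneg R}.
HB.instance Definition _ :=
  GRing.isNmodule.Build {nonneg R} addA addC add0.
HB.instance Definition _ :=
  GRing.Nmodule_isComNzSemiRing.Build {nonneg R} mulA mulC mul1 mulDl mul0 oneN0.

End NonnegSemiRing.

(* A cone is a semimodule over the semiring {nonneg R}. *)
Notation coneType R := (lSemiModType {nonneg R}).

#[short(type="topConeType")]
HB.structure Definition TopCone (R : realType) :=
  {C of Topological C & GRing.LSemiModule {nonneg R} C}.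

Definition semitopological_cone (R : realType) (C : topConeType R) : Prop :=
  (forall y : C, continuous (fun x : C => x + y)) /\
  (forall a : {nonneg R}, continuous (fun x : C => a *: x)) /\
  (forall x : C, continuous (fun a : scott {nonneg R} => (a : {nonneg R}) *: x)).

(* convType has the barycentric algebra axioms for x +_a y := x <| a |> y:
   in convA, r and s are the weights a and b of (x +_a y) +_b z, and the side
   conditions p = r * s and 1 - s = (1 - p) * (1 - q) force p = a * b and
   q = (1 - a) * b / (1 - a * b) when a, b < 1. *)

#[short(type="topConvType")]
HB.structure Definition TopConv (R : realType) :=
  {B of Topological B & ConvexSpace R B}.

Local Open Scope convex_scope.

Definition unit_itv (R : realType) : Type :=
  initial_topology (fun a : {i01 R} => a%:num : R^o).
HB.instance Definition _ (R : realType) := Topological.on (unit_itv R).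

Definition semitopological_bary (R : realType) (B : topConvType R) : Prop :=
  (forall (a : {i01 R}) (y : B), continuous (fun x : B => x <| a |> y)) /\
  (forall (a : {i01 R}) (x : B), continuous (fun y : B => x <| a |> y)) /\
  (forall x y : B, continuous (fun a : unit_itv R => x <| (a : {i01 R}) |> y)).

Definition affine (R : realType) (A B : convType R) (f : A -> B) : Prop :=
  forall a : {i01 R}, {morph f : x y / x <| a |> y}.

Definition convex_cone (R : realType) (C : coneType R) : Type := C.

Section ConvexCone.
Context {R : realType} {C' : coneType R}.
Let C := convex_cone C'.

Let avg (p : {i01 R}) (x y : C) : C :=
  p%:num%:nng *: (x : C') + (1 - p%:num)%:nng *: (y : C').

Let avg1 x y : avg 1%:i01 x y = x.
Proof.
rewrite /avg (_ : _%:nng = 1); last exact/val_inj.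
rewrite [X in _ + X *: _](_ : _ = 0 :> {nonneg R}); last by apply/val_inj; rewrite /= subrr.
by rewrite scale1r scale0r addr0.
Qed.

Let avgI p x : avg p x x = x.
Proof.
rewrite /avg -scalerDl (_ : _ + _ = 1) ?scale1r//.
by apply/val_inj; rewrite /= addrC subrK.
Qed.

Let avgC p x y : avg p x y = avg (1 - (p%:num))%:i01 y x.
Proof.
rewrite /avg addrC; congr (_ *: _ + _ *: _); apply/val_inj => //=.
by rewrite opprB addrC subrK.
Qed.

Let avgA : convex_quasi_associative avg.
Proof.
move=> p q r s a b c prs spq; rewrite /avg.
rewrite [in LHS]scalerDr [in LHS]addrA [in RHS]scalerDr !scalerA.
congr (_ *: _ + _ *: _ + _ *: _); apply/val_inj => /=.
- by rewrite mulrC prs mulrC.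
- exact: (ConvexQuasiAssoc.pq_sr prs).
- by rewrite -spq.
Qed.

HB.instance Definition _ := Choice.on C.
HB.instance Definition _ := isConvexSpace.Build R C avg1 avgI avgC avgA.
End ConvexCone.

HB.instance Definition _ (R : realType) (C : topConeType R) :=
  Topological.copy (convex_cone C) C.

Section SubConvex.
Context {R : realType} {B : convType R} {A : set B}.
Hypothesis cA : forall p x y, A x -> A y -> A (x <| p |> y).

Definition sub_conv (p : {i01 R}) (x y : A) : A :=
  exist _ (val x <| p |> val y)
    (mem_set (cA p (set_mem (valP x)) (set_mem (valP y)))).

Lemma sub_conv1 x y : sub_conv 1%:i01 x y = x.
Proof. by apply/val_inj; rewrite /= conv1. Qed.
Lemma sub_convmm p x : sub_conv p x x = x.
Proof. by apply/val_inj; rewrite /= convmm. Qed.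
Lemma sub_convC p x y : sub_conv p x y = sub_conv (1 - (p%:num))%:i01 y x.
Proof. by apply/val_inj; rewrite /= convC. Qed.
Lemma sub_convA : convex_quasi_associative sub_conv.
Proof. by move=> p q r s a b c prs spq; apply/val_inj; exact: convA. Qed.
End SubConvex.

Definition cone (R : realType) (B : convType R) : Type :=
  option ({posnum R} * B).

Section Cone.
Context {R : realType} {B : convType R}.
Implicit Types (u v : cone B) (r s : {posnum R}) (x y : B).

HB.instance Definition _ := Choice.on (cone B).

Fact weight_ge0 r s : 0 <= r%:num / (r%:num + s%:num).
Proof. by []. Qed.
Fact weight_le1 r s : r%:num / (r%:num + s%:num) <= 1.
Proof. by rewrite ler_pdivrMr// mul1r lerDl. Qed.
Definition weight r s : {i01 R} := Itv01 (weight_ge0 r s) (weight_le1 r s).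

Definition cone_add u v : cone B :=
  match u, v with
  | None, _ => v
  | _, None => u
  | Some (r, x), Some (s, y) =>
      Some ((r%:num + s%:num)%:pos, x <| weight r s |> y)
  end.

Definition cone_scale (a : {nonneg R}) u : cone B :=
  match u with
  | None => None
  | Some (r, x) =>
      if pselect (0 < a%:num) is left a_gt0
      then Some (PosNum (mulr_gt0 a_gt0 (gt0 r)), x) else None
  end.

Let addA : associative cone_add.
Proof.
move=> [[r x]|] [[s y]|] [[t z]|] //=; congr Some.
congr pair; first by apply/val_inj; rewrite /= addrA.
apply: convA => /=.
- rewrite mulrA divfK ?gt_eqF// addrA//.
- have h1 : r%:num + s%:num + t%:num != 0 by rewrite gt_eqF.
  have h2 : s%:num + t%:num != 0 by rewrite gt_eqF.
  rewrite addrA /unstable.onem.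
  have -> : 1 - (r%:num + s%:num) / (r%:num + s%:num + t%:num) =
    t%:num / (r%:num + s%:num + t%:num).
    by apply: (mulIf h1); rewrite mulrBl !divfK// mul1r addrAC subrr add0r.
  have -> : 1 - r%:num / (r%:num + s%:num + t%:num) =
    (s%:num + t%:num) / (r%:num + s%:num + t%:num).
    by apply: (mulIf h1); rewrite mulrBl !divfK// mul1r -(addrA r%:num) [LHS]addrC addKr.
  have -> : 1 - s%:num / (s%:num + t%:num) = t%:num / (s%:num + t%:num).
    by apply: (mulIf h2); rewrite mulrBl !divfK// mul1r [LHS]addrC addKr.
  by apply: (mulIf h1); rewrite divfK// mulrAC divfK// [RHS]mulrC divfK.
Qed.

Let addC : commutative cone_add.
Proof.
move=> [[r x]|] [[s y]|] //=; congr (Some (_, _)).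
  by apply/val_inj; rewrite /= addrC.
rewrite convC; congr (_ <| _ |> _); apply/val_inj => /=.
have h : s%:num + r%:num != 0 by rewrite gt_eqF.
rewrite (addrC r%:num); apply: (mulIf h).
by rewrite mulrBl !divfK// mul1r addrK.
Qed.

Let add0 : left_id (None : cone B) cone_add.
Proof. by []. Qed.

HB.instance Definition _ := GRing.isNmodule.Build (cone B) addA addC add0.

Let scaleA a b u : cone_scale a (cone_scale b u) = cone_scale (a * b) u.
Proof.
case: u => [[r x]|]//=.
case: pselect => [b0|b0] /=; last first.
  case: pselect => //= ab; exfalso; apply: b0.
  by rewrite lt0r ge0 andbT; apply: contraTneq ab => ->; rewrite mulr0 ltxx.
case: pselect => [a0|a0]; case: pselect => [ab|ab] //=.
- by congr (Some (_, _)); apply/val_inj; rewrite /= mulrA.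
- by exfalso; apply: ab; rewrite mulr_gt0.
- by exfalso; apply: a0; move: ab; rewrite pmulr_lgt0.
Qed.

Let scale0 u : cone_scale 0 u = 0.
Proof.
by case: u => [[r x]|]//=; case: pselect => //= h; exfalso; move: h; rewrite ltxx.
Qed.

Let scale1 : left_id 1 cone_scale.
Proof.
move=> [[r x]|]//=; case: pselect => //= h.
by congr (Some (_, _)); apply/val_inj; rewrite /= mul1r.
Qed.

Let scaleDr : right_distributive cone_scale +%R.
Proof.
move=> a [[r x]|] [[s y]|]//=; case: pselect => //= h.
congr (Some (_, _)); first by apply/val_inj; rewrite /= mulrDr.
congr (_ <| _ |> _); apply/val_inj => /=.
by rewrite -mulrDr -mulf_div divff ?mul1r// gt_eqF.
Qed.

Let scaleDl u : {morph cone_scale^~ u : a b / a + b}.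
Proof.
move=> a b; have [->|a0] := eqVneq a 0; first by rewrite scale0 !add0r.
have [->|b0] := eqVneq b 0; first by rewrite scale0 !addr0.
have {}a0 : 0 < a%:num by rewrite lt0r ge0 andbT.
have {}b0 : 0 < b%:num by rewrite lt0r ge0 andbT.
case: u => [[r x]|]//=.
case: pselect => [h|h]; last by exfalso; apply: h; rewrite addr_gt0.
case: pselect => // ha; case: pselect => // hb.
congr (Some (_, _)); last by rewrite convmm.
by apply/val_inj; rewrite /= mulrDl.
Qed.

HB.instance Definition _ := GRing.Nmodule_isLSemiModule.Build {nonneg R} (cone B)
  scaleA scale0 scale1 scaleDr scaleDl.

End Cone.

Definition cone_unit (R : realType) (B : convType R) (x : B) : cone B :=
  Some (1%:pos, x).

Definition cone_map (R : realType) (A B : convType R) (f : A -> B)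
  (u : cone A) : cone B := omap (fun p => (p.1, f p.2)) u.

Definition specialization_le (T : topologicalType) (x y : T) : Prop :=
  forall U : set T, open U -> U x -> U y.

Section ConeTopology.
Context {R : realType} {B : topConvType R}.

Definition cone_le (u v : cone B) : Prop :=
  (u = 0 /\ v = 0) \/
  exists s y, v = Some (s, y) /\
    exists (u' : cone B) (y1 : B),
      u + u' = Some (s, y1) /\ specialization_le y1 y.

(* W is a subset of R_+ \ {0} x B when ~ W 0. *)
Definition cone_subbase : set (set (cone B)) :=
  [set W : set (cone B) | [/\ ~ W 0,
    open [set p : scott {posnum R} * B | W (Some p)] &
    forall u v, cone_le u v -> W u -> W v]].

HB.instance Definition _ :=
  isSubBaseTopological.Build (cone B) cone_subbase idfun.

End ConeTopology.

Record opens (X : topologicalType) := Opens {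
  opens_set :> set X;
  opens_open : open opens_set }.

Section Opens.
Context {X : topologicalType}.
Implicit Types U V : opens X.

Lemma opens_inj U V : opens_set U = opens_set V -> U = V.
Proof.
by case: U V => [U oU] [V oV] /= UV; subst V; congr Opens; exact: Prop_irrelevance.
Qed.

HB.instance Definition _ := gen_eqMixin (opens X).
HB.instance Definition _ := gen_choiceMixin (opens X).

Definition opens0 : opens X := Opens open0.
Definition opensT : opens X := Opens openT.
Definition opensU U V : opens X := Opens (openU (opens_open U) (opens_open V)).
Definition opensI U V : opens X := Opens (openI (opens_open U) (opens_open V)).
Definition opens_bigcup (D : set (opens X)) : opens X :=
  Opens (bigcup_open (fun U (_ : D U) => opens_open U)).

Definition directed (D : set (opens X)) : Prop :=
  D !=set0 /\
  forall U V, D U -> D V -> exists W, [/\ D W, U `<=` W & V `<=` W].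

Definition point_opens : Type := opens X.
HB.instance Definition _ := Choice.on point_opens.
HB.instance Definition _ := isSubBaseTopological.Build point_opens
  (range (fun x : X => [set U : opens X | opens_set U x])) idfun.
End Opens.
Arguments point_opens : clear implicits.

Definition opens_preimage (X Y : topologicalType) (h : continuousType X Y)
    (V : opens Y) : opens X :=
  Opens ((continuousP h).1 (@cts_fun _ _ h) V (opens_open V)).

Local Open Scope ereal_scope.

Section ValuationProps.
Context {R : realType} {X : topologicalType}.
Implicit Type nu : opens X -> \bar R.

Definition strict nu : Prop := nu opens0 = 0.

Definition modular nu : Prop :=
  forall U V, nu U + nu V = nu (opensU U V) + nu (opensI U V).

Definition scott_continuous nu : Prop :=
  (forall U V : opens X, U `<=` V -> nu U <= nu V) /\
  (forall D, directed D -> nu (opens_bigcup D) = ereal_sup (nu @` D)).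

(* The Scott topology of [0, +oo] is its subspace topology in scott (\bar R). *)
Definition point_continuous nu : Prop :=
  continuous (nu : point_opens X -> scott (\bar R)).
End ValuationProps.

Record valuation (R : realType) (X : topologicalType) := Valuation {
  val_fun :> opens X -> \bar R;
  val_ge0 : forall U, 0 <= val_fun U;
  val_strict : strict val_fun;
  val_modular : modular val_fun;
  val_scott : scott_continuous val_fun }.

Section ValuationCone.
Context {R : realType} {X : topologicalType}.
Implicit Types (nu mu : valuation R X) (a b : {nonneg R}).

Lemma valuation_ext nu mu : (forall U, nu U = mu U) -> nu = mu.
Proof.
case: nu mu => [f f0 fs fm fc] [g g0 gs gm gc] /= /funext fg; subst g.
by congr Valuation; exact: Prop_irrelevance.
Qed.

HB.instance Definition _ := gen_eqMixin (valuation R X).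
HB.instance Definition _ := gen_choiceMixin (valuation R X).

Let val_le nu (U V : opens X) : U `<=` V -> nu U <= nu V.
Proof. exact: (val_scott nu).1. Qed.

Let val_sup nu D : directed D -> nu (opens_bigcup D) = ereal_sup (nu @` D).
Proof. exact: (val_scott nu).2. Qed.

Program Definition val_zero : valuation R X :=
  @Valuation R X (fun=> 0) _ _ _ _.
Next Obligation. by []. Qed.
Next Obligation. by []. Qed.
Next Obligation. by move=> U V; rewrite adde0. Qed.
Next Obligation.
split=> // D [[U DU] _].
rewrite (_ : _ @` D = [set 0]) ?ereal_sup1//.
by apply/seteqP; split=> [_ [V _ <-]//|_ ->]; exists U.
Qed.

Program Definition val_add nu mu : valuation R X :=
  @Valuation R X (fun U => nu U + mu U) _ _ _ _.
Next Obligation. by move=> nu mu U; apply: adde_ge0; exact: val_ge0. Qed.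
Next Obligation. by move=> nu mu; rewrite /strict !val_strict adde0. Qed.
Next Obligation.
by move=> nu mu U V /=; rewrite addeACA (val_modular nu) (val_modular mu) addeACA.
Qed.
Next Obligation.
move=> nu mu; split=> [U V UV|D dD] /=; first by rewrite leeD ?val_le.
rewrite !val_sup//; apply/eqP; rewrite eq_le; apply/andP; split; last first.
  apply: ge_ereal_sup => _ [U DU <-].
  by apply: leeD; apply: ereal_sup_ubound; exists U.
set s := (X in _ <= X).
have ub U V : D U -> D V -> nu U + mu V <= s.
  move=> DU DV; have [W [DW UW VW]] := dD.2 _ _ DU DV.
  apply: (@le_trans _ _ (nu W + mu W)); first by rewrite leeD ?val_le.
  by apply: ereal_sup_ubound; exists W.
have [U0 DU0] := dD.1.
have s0 : 0 <= s.
  by apply: le_trans (ub _ _ DU0 DU0); rewrite adde_ge0 ?val_ge0.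
case: (ltgtP s +oo) => [soo||->]; [|by rewrite ltNge leey|by rewrite leey].
have sfin : s \is a fin_num by rewrite ge0_fin_numE.
have nufin U : D U -> nu U \is a fin_num.
  move=> DU; rewrite ge0_fin_numE ?val_ge0//; apply: le_lt_trans soo.
  by apply: le_trans (ub _ _ DU DU0); rewrite leeDl ?val_ge0.
have le1 U : D U -> nu U + ereal_sup (mu @` D) <= s.
  move=> DU; rewrite addeC -leeBrDr ?nufin//.
  by apply: ge_ereal_sup => _ [V DV <-]; rewrite leeBrDr ?nufin// addeC ub.
have musupfin : ereal_sup (mu @` D) \is a fin_num.
  rewrite ge0_fin_numE; last first.
    by apply: le_trans (val_ge0 mu U0) _; apply: ereal_sup_ubound; exists U0.
  apply: le_lt_trans soo; apply: le_trans (le1 _ DU0).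
  by rewrite leeDr ?val_ge0.
rewrite -leeBrDr//; apply: ge_ereal_sup => _ [U DU <-].
by rewrite leeBrDr// le1.
Qed.

Program Definition val_scale a nu : valuation R X :=
  @Valuation R X (fun U => (a%:num)%:E * nu U) _ _ _ _.
Next Obligation. by move=> a nu U; rewrite mule_ge0 ?val_ge0 ?lee_fin. Qed.
Next Obligation. by move=> a nu; rewrite /strict val_strict mule0. Qed.
Next Obligation.
by move=> a nu U V /=; rewrite -!ge0_muleDr ?val_ge0// val_modular.
Qed.
Next Obligation.
move=> a nu; split=> [U V UV|D dD] /=; first by rewrite lee_wpmul2l ?lee_fin// val_le.
rewrite val_sup// -ereal_supZl//; last first.
  by apply/set0P; have [U DU] := dD.1; exists (nu U); exists U.
congr ereal_sup; apply/seteqP; split=> [_ [_ [U DU <-] <-]|_ [U DU <-]].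
  by exists U.
by exists (nu U) => //; exists U.
Qed.

Let addA : associative val_add.
Proof. by move=> f g h; apply: valuation_ext => U /=; rewrite addeA. Qed.
Let addC : commutative val_add.
Proof. by move=> f g; apply: valuation_ext => U /=; rewrite addeC. Qed.
Let add0 : left_id val_zero val_add.
Proof. by move=> f; apply: valuation_ext => U /=; rewrite add0e. Qed.

HB.instance Definition _ := GRing.isNmodule.Build (valuation R X) addA addC add0.

Let scaleA a b nu : val_scale a (val_scale b nu) = val_scale (a * b)%R nu.
Proof. by apply: valuation_ext => U /=; rewrite muleA. Qed.
Let scale0 nu : val_scale 0%R nu = 0%R.
Proof. by apply: valuation_ext => U /=; rewrite mul0e. Qed.
Let scale1 : left_id 1%R val_scale.
Proof. by move=> nu; apply: valuation_ext => U /=; rewrite mul1e. Qed.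
Let scaleDr : right_distributive val_scale +%R.
Proof.
by move=> a nu mu; apply: valuation_ext => U /=; rewrite ge0_muleDr ?val_ge0.
Qed.
Let scaleDl nu : {morph val_scale^~ nu : a b / (a + b)%R}.
Proof.
move=> a b; apply: valuation_ext => U /=.
by rewrite EFinD ge0_muleDl ?lee_fin.
Qed.

HB.instance Definition _ := GRing.Nmodule_isLSemiModule.Build
  {nonneg R} (valuation R X) scaleA scale0 scale1 scaleDr scaleDl.

HB.instance Definition _ := isSubBaseTopological.Build (valuation R X)
  [set W | exists (U : opens X) (r : R), (0 < r)%R /\
     W = [set nu : valuation R X | r%:E < nu U]] idfun.

End ValuationCone.

Section PointContinuous.
Context {R : realType} {X : topologicalType}.
Implicit Types nu mu : valuation R X.

Let superadd_split (r x y : \bar R) : 0 <= x -> 0 <= y -> r < x + y ->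
  exists a b, [/\ a < x, b < y & forall t s, a < t -> b < s -> 0 <= t -> 0 <= s -> r < t + s].
Proof.
move=> x0 y0 rxy.
case: r rxy => [r| |] rxy; last first.
- exists (-1)%:E, (-1)%:E; split.
  + by apply: lt_le_trans x0; rewrite lte_fin ltrN10.
  + by apply: lt_le_trans y0; rewrite lte_fin ltrN10.
  + by move=> t s _ _ t0 s0; apply: lt_le_trans (adde_ge0 t0 s0); exact: ltNyr.
- by move: rxy; rewrite ltNge leey.
case: x x0 rxy => [x| |] x0 rxy //; last first.
  exists (maxe r%:E 0), (-1)%:E; split.
  - by rewrite gt_max !ltry.
  - by apply: lt_le_trans y0; rewrite lte_fin ltrN10.
  - move=> t s; rewrite gt_max => /andP[rt _] _ t0 s0.
    by apply: lt_le_trans rt _; rewrite leeDl.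
case: y y0 rxy => [y| |] y0 rxy //; last first.
  exists (-1)%:E, (maxe r%:E 0); split.
  - by apply: lt_le_trans x0; rewrite lte_fin ltrN10.
  - by rewrite gt_max !ltry.
  - move=> t s _; rewrite gt_max => /andP[rs _] t0 s0.
    by apply: lt_le_trans rs _; rewrite leeDr.
move: rxy; rewrite -EFinD lte_fin => rxy.
exists (x - (x + y - r) / 2)%:E, (y - (x + y - r) / 2)%:E; split.
- by rewrite lte_fin ltrBlDr ltrDl divr_gt0// subr_gt0.
- by rewrite lte_fin ltrBlDr ltrDl divr_gt0// subr_gt0.
- move=> t s at' bs _ _; have := lteD at' bs; rewrite -EFinD.
  suff -> : (x - (x + y - r) / 2 + (y - (x + y - r) / 2) = r)%R by [].
  rewrite addrACA -opprD -splitr.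
  by rewrite opprB addrC subrK.
Qed.

Lemma point_continuousD nu mu : point_continuous nu -> point_continuous mu ->
  point_continuous (nu + mu)%R.
Proof.
move=> /scott_continuousP cnu /scott_continuousP cmu.
apply/scott_continuousP => r; rewrite openE => U /= rU.
have [a [b [aU bU H]]] := superadd_split (val_ge0 nu U) (val_ge0 mu U) rU.
rewrite /interior nbhsE /=.
exists ([set V : point_opens X | a < nu V] `&` [set V : point_opens X | b < mu V]).
  by split=> //; exact: openI.
by move=> V [/= aV bV]; apply: H => //; exact: val_ge0.
Qed.

Lemma point_continuousZ (c : {nonneg R}) nu : point_continuous nu ->
  point_continuous (c *: nu)%R.
Proof.
have [->|c0] := eqVneq c 0%R.
  move=> _; rewrite scale0r; exact: cst_continuous.
have {}c0 : (0 < c%:num)%R by rewrite lt0r ge0 andbT.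
move=> /scott_continuousP cnu; apply/scott_continuousP => r.
rewrite (_ : [set _ | _] = [set V : point_opens X | (c%:num^-1)%:E * r < nu V]); first exact: cnu.
by apply/seteqP; split=> V /=; rewrite lte_pdivrMl.
Qed.
End PointContinuous.

Section Subspaces.
Variables (R : realType) (X : topologicalType).

Definition bounded : set (valuation R X) := [set nu | nu opensT < +oo].
Definition normalized : set (valuation R X) := [set nu | nu opensT = 1].
Definition point_bounded : set (valuation R X) :=
  bounded `&` [set nu | point_continuous nu].
Definition point_normalized : set (valuation R X) :=
  normalized `&` [set nu | point_continuous nu].

Definition Vb : Type := set_type bounded.
Definition V1 : Type := set_type normalized.
Definition Vbp : Type := set_type point_bounded.
Definition V1p : Type := set_type point_normalized.

HB.instance Definition _ := Topological.copy Vb (set_type bounded).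
HB.instance Definition _ := Topological.copy V1 (set_type normalized).
HB.instance Definition _ := Topological.copy Vbp (set_type point_bounded).
HB.instance Definition _ := Topological.copy V1p (set_type point_normalized).

Fact boundedP : subsemimod_closed (fun nu => nu \in bounded).
Proof.
split; first split; rewrite ?inE /bounded /= ?ltry//.
- by move=> nu mu; rewrite !inE /bounded /= => nuy muy; rewrite lte_add_pinfty.
- move=> a nu; rewrite !inE /bounded /= => nuy.
  by rewrite lte_mul_pinfty ?lee_fin.
Qed.

Fact point_boundedP : subsemimod_closed (fun nu => nu \in point_bounded).
Proof.
have [[b0 bD] bZ] := boundedP; split; first split.
- by rewrite !inE in b0 *; split=> //; exact: cst_continuous.
- move=> nu mu; rewrite !inE => -[nub nup] [mub mup]; split.
    by have := bD _ _ (mem_set nub) (mem_set mub); rewrite inE.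
  exact: point_continuousD.
- move=> a nu; rewrite !inE => -[nub nup]; split.
    by have := bZ a _ (mem_set nub); rewrite inE.
  exact: point_continuousZ.
Qed.

HB.instance Definition _ := SubChoice.copy Vb (set_type bounded).
HB.instance Definition _ := GRing.SubChoice_isSubLSemiModule.Build
  {nonneg R} (valuation R X) _ Vb boundedP.

HB.instance Definition _ := SubChoice.copy Vbp (set_type point_bounded).
HB.instance Definition _ := GRing.SubChoice_isSubLSemiModule.Build
  {nonneg R} (valuation R X) _ Vbp point_boundedP.

Fact normalized_conv (p : {i01 R}) (nu mu : convex_cone (valuation R X)) :
  normalized nu -> normalized mu -> normalized (nu <| p |> mu).
Proof.
rewrite /normalized /= => -> ->.
by rewrite !mule1 -EFinD addrC subrK.
Qed.

Fact point_normalized_conv (p : {i01 R})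
    (nu mu : convex_cone (valuation R X)) :
  point_normalized nu -> point_normalized mu ->
  point_normalized (nu <| p |> mu).
Proof.
move=> [nu1 nup] [mu1 mup]; split; first exact: normalized_conv.
by apply: point_continuousD; exact: point_continuousZ.
Qed.

HB.instance Definition _ := isConvexSpace.Build R V1
  (sub_conv1 normalized_conv) (sub_convmm normalized_conv)
  (sub_convC normalized_conv) (sub_convA normalized_conv).

HB.instance Definition _ := isConvexSpace.Build R V1p
  (sub_conv1 point_normalized_conv) (sub_convmm point_normalized_conv)
  (sub_convC point_normalized_conv) (sub_convA point_normalized_conv).

Fact normalized_bounded : normalized `<=` bounded.
Proof. by move=> nu; rewrite /normalized /bounded /= => ->; exact: ltry. Qed.

Fact point_normalized_bounded : point_normalized `<=` point_bounded.
Proof. by move=> nu [/normalized_bounded]. Qed.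

Definition V1_incl (nu : V1) : Vb :=
  exist _ (val nu) (mem_set (normalized_bounded (set_mem (valP nu)))).

Definition V1p_incl (nu : V1p) : Vbp :=
  exist _ (val nu) (mem_set (point_normalized_bounded (set_mem (valP nu)))).

End Subspaces.

Section Image.
Context {R : realType} {X Y : topologicalType} (h : continuousType X Y).

Program Definition val_image (nu : valuation R X) : valuation R Y :=
  @Valuation R Y (fun V => nu (opens_preimage h V)) _ _ _ _.
Next Obligation. by move=> nu V; exact: val_ge0. Qed.
Next Obligation.
by move=> nu; rewrite /strict -(val_strict nu); congr (nu _); exact: opens_inj.
Qed.
Next Obligation.
move=> nu U V /=; rewrite val_modular.
by congr (nu _ + nu _); exact: opens_inj.
Qed.
Next Obligation.
move=> nu; have [nuS nuD] := val_scott nu.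
split=> [U V UV|D [[U0 DU0] dD]] /=; first by apply: nuS => x; exact: UV.
have -> : opens_preimage h (opens_bigcup D) =
    opens_bigcup (opens_preimage h @` D).
  apply: opens_inj; apply/seteqP; split=> [x [V DV Vx]|x [_ [V DV <-] Vx]].
    by exists (opens_preimage h V) => //; exists V.
  by exists V.
rewrite nuD ?image_comp//; split; first by exists (opens_preimage h U0), U0.
move=> _ _ [U DU <-] [V DV <-]; have [W [DW UW VW]] := dD _ _ DU DV.
by exists (opens_preimage h W); split; [exists W|move=> x; exact: UW
  |move=> x; exact: VW].
Qed.

Fact val_imageT (nu : valuation R X) : val_image nu opensT = nu opensT.
Proof. by congr (nu _); exact: opens_inj. Qed.

Fact val_image_bounded nu : bounded nu -> bounded (val_image nu).
Proof. by move=> nub; have := val_imageT nu; rewrite /bounded/= => ->. Qed.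

Fact val_image_normalized nu : normalized nu -> normalized (val_image nu).
Proof. by move=> nu1; have := val_imageT nu; rewrite /normalized/= => ->. Qed.

Definition Vb_map (nu : Vb R X) : Vb R Y :=
  exist _ (val_image (val nu))
    (mem_set (val_image_bounded (set_mem (valP nu)))).

Definition V1_map (nu : V1 R X) : V1 R Y :=
  exist _ (val_image (val nu))
    (mem_set (val_image_normalized (set_mem (valP nu)))).

End Image.

Local Close Scope ereal_scope.

Definition extends {B M C : Type} (i : B -> M) (f : B -> C) (g : M -> C) : Prop :=
  forall x, g (i x) = f x.

Definition free_cone (R : realType) (B : convType R) (M : coneType R)
    (i : B -> convex_cone M) : Prop :=
  affine i /\
  forall (C : coneType R) (f : B -> convex_cone C), affine f ->
    exists2 g : {linear M -> C}, extends i f g &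
      forall g' : {linear M -> C}, extends i f g' -> g' =1 g.

Definition free_semitopological_cone (R : realType) (B : topConvType R)
    (M : topConeType R) (i : B -> convex_cone M) : Prop :=
  [/\ semitopological_bary B, semitopological_cone M, affine i, continuous i &
    forall (C : topConeType R) (f : B -> convex_cone C),
      semitopological_cone C -> affine f -> continuous f ->
      exists2 g : {linear M -> C}, extends i f g /\ continuous g &
        forall g' : {linear M -> C}, extends i f g' -> continuous g' ->
          g' =1 g].

Definition semitopological_cone_iso (R : realType) (M N : topConeType R)
    (phi : {linear M -> N}) : Prop :=
  [/\ semitopological_cone M, semitopological_cone N, continuous phi &
    exists psi : N -> M, [/\ cancel phi psi, cancel psi phi & continuous psi]].

(* Main.v *)
Require Import Defs.
From HB Require Import structures.
From mathcomp Require Import all_boot all_order all_algebra finmap.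
From mathcomp Require Import all_classical all_reals topology normedtype.
From mathcomp Require Import interval_inference ereal convex lra.
Set Implicit Arguments.
Unset Strict Implicit.
Unset Printing Implicit Defensive.
Import Order.TTheory GRing.Theory Num.Theory numFieldNormedType.Exports.
Local Open Scope classical_set_scope.
Local Open Scope ring_scope.
Local Open Scope convex_scope.

(** A bounded valuation nu other than 0 is r *: mu for exactly one r > 0 and one
    normalized mu, namely r = nu X and mu = nu / r. So every affine map f on
    normalized valuations has a single possible linear extension,
    nu |-> nu X *: f (nu / nu X), and the algebraic half of the theorem says no
    more than that cone(B) is the free cone over B and that r *: mu <-> (r, mu)
    identifies cone(V1 X) with Vb X.

    Continuity of that extension is the real content, since nu |-> nu X is only
    lower semicontinuous and nu |-> nu / nu X is not continuous. It is enough to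
    see that the bijection cone(V1 X) <-> Vb X is a homeomorphism:
    [cone_lift_continuous] shows that cone(B) is also the free semitopological
    cone over B, and everything about Vb X is then transported along the
    bijection, including the fact that cone(V1 X) is semitopological.

    The map from cone(V1 X) to Vb X is continuous because it is itself a
    [cone_lift]. For the inverse map [psi], let nu0 = r0 *: mu0, let (r0, mu0)
    belong to a subbasic open set A of the cone, and choose q < r0 and opens
    U_1, ..., U_n with thresholds such that A contains (q, mu) whenever the mu U_k
    exceed the thresholds. Let L be the finite lattice of opens generated by the
    U_k. The valuations nu with nu V >= q * mu0 V for all V in L form a
    neighbourhood of nu0, because q < r0. Each of them splits as nu1 + nu2 where
    nu1 still dominates q *: mu0 on L but has total mass exactly q
    ([dominated_summand]). Hence psi nu = (q, nu1 / q) + psi nu2 is above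
    (q, nu1 / q) in the cone ordering, (q, nu1 / q) is in A by the choice of the
    U_k, and A is upward closed.

    To find nu1, cut nu into pieces along the opens of L until every piece
    lies, as far as L can tell, entirely inside or entirely outside each V in L.
    Shrink the pieces one after the other, each as far as domination permits.
    A shrunk piece that has not vanished is then inside a tight open, that is,
    one where the inequality is an equality. By modularity the tight opens are
    closed under union, so one tight open carries all the remaining mass, and
    this mass is therefore at most q.

    The argument only uses that a class of bounded valuations is closed under
    sums, scaling and splitting along an open set. Point-continuous valuations
    have these properties too, so both halves of the theorem are instances of
    [valuation_cone_iso]. *)

(** * Subbases and the Scott topology *)

Lemma near_all (T : Type) (I : eqType) (F : set_system T) {FF : Filter F} (s : seq I)
    (P : I -> T -> Prop) :
  (forall i, i \in s -> F (P i)) -> F [set x | forall i, i \in s -> P i x].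
Proof.
elim: s => [|a s ih] sP; first by apply: filterS filterT.
have := ih (fun i is_ => sP i (mem_behead (s := a :: s) is_)).
apply: filterS2 (sP a (mem_head _ _)) => x Pa Ps i.
by rewrite inE => /predU1P[->//|]; exact: Ps.
Qed.

(** The members of [D] are open, and finitely many of them around a given point
    fit into any open set around it. *)
Definition is_subbase (T : topologicalType) (D : set (set T)) : Prop :=
  D `<=` open /\
  forall (O : set T) x, open O -> O x -> exists s : seq (set T),
    (forall A, A \in s -> D A /\ A x) /\
    (forall y, (forall A, A \in s -> A y) -> O y).

Section Subbase.
Variable (T : topologicalType) (D : set (set T)).

(** A topology built by [isSubBaseTopological] satisfies the hypothesis by
    computation. *)
Lemma open_from_subbase :
  (open : set (set T)) =
    [set \bigcup_(A in E) A | E in [set E | E `<=` finI_from D idfun]] ->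
  is_subbase D.
Proof.
move=> topE; split=> [A DA|O x oO Ox].
  rewrite topE; exists [set A]; last by rewrite bigcup_set1.
  by move=> _ ->; exact: (finI_from1 idfun).
move: oO Ox; rewrite topE => -[E ED <-] [A EA Ax]; have [F FD AE] := ED _ EA.
exists F; split=> [C CF|y Fy]; last by exists A => //; rewrite -AE.
split; first by have := FD _ CF; rewrite inE.
by move: Ax; rewrite -AE; apply.
Qed.

Lemma subbase_continuous (S : topologicalType) (g : S -> T) : is_subbase D ->
  (forall A, D A -> open (g @^-1` A)) -> continuous g.
Proof.
move=> [_ DE] gD; apply/continuousP => O oO; rewrite openE => x /= Ogx.
have [s [sD sO]] := DE _ _ oO Ogx.
have nbA A : A \in s -> nbhs x (g @^-1` A).
  by move=> /sD[DA Agx]; apply: open_nbhs_nbhs; split=> //; exact: gD.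
by apply: filterS (near_all nbA) => y; exact: sO.
Qed.

End Subbase.

Section ScottTopology.
Context {d} (T : orderType d).

Lemma scott_subbase : is_subbase (@scott_rays d T).
Proof. exact: open_from_subbase. Qed.

(** Finitely many rays around [t] intersect in a single ray, by linearity of
    the order, or in everything when there are none. *)
Lemma scott_openP (O : set (scott T)) (t : T) : open O -> O t ->
  O = setT \/ exists2 a : T, (a < t)%O & forall s : T, (a < s)%O -> O s.
Proof.
move=> oO Ot; have [s [sD sO]] := scott_subbase.2 _ _ oO Ot.
have : (forall y, forall A, A \in s -> A y) \/ exists2 a : T, (a < t)%O &
    forall u : T, (a < u)%O -> forall A, A \in s -> A u.
  elim: s sD {sO} => [|A s ih] sD; first by left.
  right; have [[a _ Aa] At] := sD _ (mem_head _ _).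
  have at_ : (a < t)%O by move: At; rewrite -Aa.
  have [sT|[b bt sb]] := ih (fun C Cs => sD C (mem_behead (s := A :: s) Cs)).
    exists a => // u au C; rewrite inE => /predU1P[->|]; last exact: sT.
    by rewrite -Aa.
  exists (Order.max a b); first by rewrite gt_max at_.
  move=> u; rewrite gt_max => /andP[au bu] C; rewrite inE => /predU1P[->|].
    by rewrite -Aa.
  exact: sb.
move=> [sT|[a at_ sa]]; [left|right].
  by apply/seteqP; split=> // y _; apply: sO; exact: sT.
by exists a => // u au; apply: sO; exact: sa.
Qed.

End ScottTopology.

(** * Open sets of semitopological cones *)

Section SemitopologicalCone.
Context {R : realType} {C : topConeType R}.
Hypothesis sC : semitopological_cone C.

(** The map a |-> x + a *: y is Scott-continuous, so its inverse image of [W],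
    which contains 0, contains every a >= 0. *)
Lemma semitop_open_addr (W : set C) (x y : C) : open W -> W x -> W (x + y).
Proof.
move=> oW Wx; have [addc [_ scalec]] := sC.
have c : continuous (fun a : scott {nonneg R} => (a : {nonneg R}) *: y + x).
  by move=> a; exact: (continuous_comp (g := +%R^~ x) (scalec y a) (addc x _)).
have oW' := (continuousP _).1 c _ oW.
have : (fun a : scott {nonneg R} => (a : {nonneg R}) *: y + x) @^-1` W = setT.
  have W0 : ((fun a : scott {nonneg R} => (a : {nonneg R}) *: y + x) @^-1` W)
    (0 : {nonneg R}) by rewrite /= scale0r add0r.
  have [//|[a]] := scott_openP oW' W0.
  by rewrite -num_lt /= ltNge ge0.
move=> /seteqP[_ /(_ (1 : {nonneg R}) I)] /=.
by rewrite scale1r addrC.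
Qed.

(** Strict shrinking makes the scaling action jointly continuous: rays are
    generated by their left end points, so a neighbourhood of a product
    r *: x only has to be found for a single q < r. *)
Lemma semitop_open_shrink (W : set C) (r : {posnum R}) (x : C) :
  open W -> W (r%:num%:nng *: x) ->
  exists2 q : {posnum R}, q%:num < r%:num & W (q%:num%:nng *: x).
Proof.
move=> oW Wx; have [_ [_ scalec]] := sC.
have oW' := (continuousP _).1 (scalec x) _ oW.
have [/seteqP[_ WT]|[a]] := scott_openP (t := r%:num%:nng) oW' Wx.
  exists (r%:num / 2)%:pos => /=; last exact: (WT ((r%:num / 2)%:pos)%:num%:nng I).
  by rewrite ltr_pdivrMr// ltr_pMr// ltr1n.
rewrite -num_lt /= => ar aW.
exists ((a%:num + r%:num) / 2)%:pos; first by rewrite /= midf_lt.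
by apply: aW; rewrite -num_lt /= midf_lt.
Qed.

Lemma semitop_open_scale_le (W : set C) (a b : {nonneg R}) (x : C) :
  open W -> a%:num <= b%:num -> W (a *: x) -> W (b *: x).
Proof.
move=> oW ab Wa; have ba0 : 0 <= b%:num - a%:num by rewrite subr_ge0.
have -> : b = a + NngNum ba0 by apply/val_inj; rewrite /= addrC subrK.
by rewrite scalerDl; exact: semitop_open_addr.
Qed.

End SemitopologicalCone.

Lemma cone_subbase_is_subbase (R : realType) (B : topConvType R) :
  is_subbase (@cone_subbase R B).
Proof. exact: open_from_subbase. Qed.

(** * The free cone over a barycentric algebra *)

Section ConeLift.
Context {R : realType} {B : convType R} {C : coneType R}.
Variable f : B -> convex_cone C.

Definition cone_lift (u : cone B) : C :=
  if u is Some (r, x) then r%:num%:nng *: (f x : C) else 0.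

Hypothesis af : affine f.

Lemma convex_coneE (p : {i01 R}) (x y : convex_cone C) :
  x <| p |> y = p%:num%:nng *: (x : C) + (1 - p%:num)%:nng *: (y : C) :> C.
Proof. by []. Qed.

Lemma cone_lift_semilinear : semilinear cone_lift.
Proof.
split=> [a [[r x]|]|[[r x]|] [[s y]|]]; rewrite /= ?scaler0 ?add0r ?addr0//.
- rewrite -[a *: _]/(cone_scale a (Some (r, x))) /=.
  case: pselect => [a0|a0] /=.
    by rewrite scalerA; congr (_ *: _); exact/val_inj.
  have a00 : a = 0 by apply/val_inj/eqP; rewrite /= eq_le ge0 andbT leNgt; exact/negP.
  by rewrite a00 scale0r.
- have rs0 : r%:num + s%:num != 0 by rewrite gt_eqF.
  rewrite af convex_coneE scalerDr !scalerA.
  congr (_ *: _ + _ *: _); apply/val_inj => /=; first by rewrite mulrC divfK.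
  by rewrite mulrBr mulr1 mulrC divfK// addrC addKr.
Qed.

HB.instance Definition _ :=
  GRing.isSemilinear.Build {nonneg R} (cone B) C _ cone_lift cone_lift_semilinear.

Definition cone_lift_linear : {linear cone B -> C} := cone_lift.

Lemma cone_SomeE (r : {posnum R}) (x : B) :
  Some (r, x) = r%:num%:nng *: cone_unit x :> cone B.
Proof.
rewrite /cone_unit /GRing.scale /=; case: pselect => [r0|[]//].
by congr (Some (_, _)); apply/val_inj; rewrite /= mulr1.
Qed.

Lemma cone_lift_unit : extends (@cone_unit R B) f cone_lift.
Proof. by move=> x; rewrite /= (_ : _%:nng = 1) ?scale1r//; exact/val_inj. Qed.

Lemma cone_lift_uniq (g : {linear cone B -> C}) :
  extends (@cone_unit R B) f g -> g =1 cone_lift.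
Proof.
move=> gf [[r x]|]; last exact: (raddf0 g).
by rewrite [in LHS]cone_SomeE linearZ_LR gf.
Qed.

End ConeLift.

Section ConeLiftContinuous.
Context {R : realType} {B : topConvType R} {C : topConeType R}.
Variable f : B -> convex_cone C.
Hypotheses (sC : semitopological_cone C) (af : affine f) (cf : continuous f).

Let scale_f_continuous (a : {nonneg R}) : continuous (fun y => a *: (f y : C)).
Proof.
by move=> y; exact: (@continuous_comp B C C f ( *:%R a) y (@cf y) (sC.2.1 a (f y))).
Qed.

(** If an open [W] does not contain 0, its inverse image is one of the subbasic
    sets of the cone topology: joint openness comes from strict shrinking, and
    upward closure holds because [W] is stable under adding elements while
    continuity of r *: f makes it respect the specialization preorder. *)
Lemma cone_lift_continuous : continuous (cone_lift f).
Proof.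
apply/continuousP => W oW.
have [W0|W0] := pselect (W 0).
  rewrite (_ : _ @^-1` _ = setT); first exact: openT.
  apply/seteqP; split=> // u _ /=.
  by rewrite -[cone_lift f u]add0r; exact: semitop_open_addr.
apply: (cone_subbase_is_subbase B).1; split=> //.
- rewrite openE => -[r x] /= Wrx; have [q qr Wq] := semitop_open_shrink sC oW Wrx.
  exists ([set t : {posnum R} | (q < t)%O], [set y | W (q%:num%:nng *: (f y : C))]).
    split=> /=.
      apply: open_nbhs_nbhs; split; last by rewrite /= -num_lt.
      by apply: (scott_subbase _).1; exists q.
    apply: open_nbhs_nbhs; split=> //.
    exact: ((continuousP _).1 (@scale_f_continuous q%:num%:nng) _ oW).
  move=> [t y] [/= qt Wy]; apply: semitop_open_scale_le Wy => //=.
  by rewrite -num_lt in qt; exact: ltW.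
- move=> u v [[-> ->]//|[s [y [-> [u' [y1 [uu' y1y]]]]]]] Wu.
  have : W (cone_lift f (u + u')).
    by rewrite (cone_lift_semilinear af).2; exact: semitop_open_addr.
  rewrite uu'; apply: (y1y [set z | W (s%:num%:nng *: (f z : C))]).
  exact: ((continuousP _).1 (@scale_f_continuous s%:num%:nng) _ oW).
Qed.

End ConeLiftContinuous.

(** * Cones isomorphic to a free cone *)

Section FreeFromIso.
Context {R : realType} {B : convType R} {M : coneType R}.
Variables (i : B -> convex_cone M) (psi : M -> cone B).
Hypotheses (ai : affine i).
Hypotheses (phiK : cancel (cone_lift i) psi) (psiK : cancel psi (cone_lift i)).

Lemma base_inverse_semilinear : semilinear psi.
Proof. exact: (@can2_semilinear _ _ _ (cone_lift_linear ai) psi phiK psiK). Qed.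

HB.instance Definition _ :=
  GRing.isSemilinear.Build {nonneg R} M (cone B) _ psi base_inverse_semilinear.

Section Extension.
Context {C : coneType R} (f : B -> convex_cone C).
Hypothesis af : affine f.

Definition base_extension : {linear M -> C} :=
  (cone_lift_linear af : {linear cone B -> C}) \o psi.

Lemma base_extensionE : base_extension =1 cone_lift f \o psi.
Proof. by []. Qed.

Lemma base_extension_extends : extends i f base_extension.
Proof.
move=> x; rewrite base_extensionE /= -(cone_lift_unit i x).
by rewrite phiK; exact: cone_lift_unit.
Qed.

Lemma base_extension_uniq (g : {linear M -> C}) : extends i f g -> g =1 base_extension.
Proof.
move=> gf x; rewrite base_extensionE /= -{1}(psiK x).
apply: (cone_lift_uniq (f := f) (g := g \o cone_lift_linear ai : {linear _ -> _})).
by move=> b /=; rewrite -gf; congr (g _); exact: cone_lift_unit.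
Qed.
End Extension.

Lemma free_cone_of_iso : free_cone i.
Proof.
split=> // C f af; exists (base_extension af); first exact: base_extension_extends.
exact: base_extension_uniq.
Qed.

End FreeFromIso.

Section FreeSemitopFromIso.
Context {R : realType} {B : topConvType R} {M : topConeType R}.
Variables (i : B -> convex_cone M) (psi : M -> cone B).
Hypotheses (ai : affine i).
Hypotheses (phiK : cancel (cone_lift i) psi) (psiK : cancel psi (cone_lift i)).
Hypotheses (cpsi : continuous psi) (sM : semitopological_cone M).

(** A linear extension is unique even among discontinuous ones, so it is
    the composite of two continuous maps through cone(B). *)
Lemma extension_continuous (C : topConeType R) (f : B -> convex_cone C)
    (g : {linear M -> C}) :
  semitopological_cone C -> affine f -> continuous f -> extends i f g -> continuous g.
Proof.
move=> sC af cf gf.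
have -> : (g : M -> C) = cone_lift f \o psi.
  by apply/funext; exact: (base_extension_uniq ai phiK psiK af).
have cl := cone_lift_continuous sC af cf.
by move=> x; exact: (@continuous_comp _ _ _ _ _ _ (@cpsi x) (@cl _)).
Qed.

Lemma free_semitopological_of_iso : semitopological_bary B -> continuous i ->
  free_semitopological_cone i.
Proof.
move=> sB ci; split=> // C f sC af cf.
have [_ /(_ C f af)[g gf gu]] := free_cone_of_iso ai phiK psiK.
exists g; first by split=> //; exact: extension_continuous gf.
by move=> g' g'f _; exact: gu.
Qed.

Hypothesis ci : continuous i.

Let cphi : continuous (cone_lift i). Proof. exact: cone_lift_continuous. Qed.

(** The operations of cone(B) are those of [M] seen through a homeomorphism. *)
Lemma cone_semitopological_of_iso : semitopological_cone (cone B).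
Proof.
have psiE := base_inverse_semilinear ai phiK psiK.
have [sMD [sMZ sMS]] := sM.
have transport (T : topologicalType) (h : T -> M) :
    continuous h -> continuous (psi \o h).
  by move=> ch x; exact: (@continuous_comp _ _ _ _ _ _ (ch x) (@cpsi _)).
have comp (h : M -> M) : continuous h -> continuous (psi \o (h \o cone_lift i)).
  move=> ch; apply: transport => x.
  exact: (@continuous_comp _ _ _ _ _ _ (@cphi x) (ch _)).
split; last split.
- move=> v.
  have -> : (fun u => u + v) = psi \o ((fun x => x + cone_lift i v) \o cone_lift i).
    by apply/funext => u; rewrite /= psiE.2 !phiK.
  exact: comp.
- move=> a; have -> : (fun u => a *: u) = psi \o (( *:%R a) \o cone_lift i).
    by apply/funext => u; rewrite /= psiE.1 !phiK.
  exact: comp.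
- move=> u; rewrite (_ : (fun a => _) =
      psi \o (fun a : scott {nonneg R} => (a : {nonneg R}) *: cone_lift i u)).
    exact: transport.
  by apply/funext => a; rewrite /= psiE.1 !phiK.
Qed.

Lemma cone_iso_of_iso : semitopological_cone_iso (cone_lift_linear ai).
Proof. by split=> //; [exact: cone_semitopological_of_iso|exists psi]. Qed.

End FreeSemitopFromIso.

(** * Splitting valuations along an open set *)

Section Mass.
Context {R : realType} {X : topologicalType}.
Implicit Types (nu mu : valuation R X) (U V : opens X).

(** Bounded valuations take real values; working with those turns the
    inequalities below into linear arithmetic over [R]. *)
Definition mass nu U : R := fine (nu U).

Lemma massE nu U : bounded nu -> nu U = (mass nu U)%:E.
Proof.
move=> nub; rewrite fineK// ge0_fin_numE ?val_ge0//.
by apply: le_lt_trans nub; apply: (val_scott nu).1.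
Qed.

Lemma mass_ge0 nu U : 0 <= mass nu U.
Proof. exact/fine_ge0/val_ge0. Qed.

Lemma mass0 nu : mass nu opens0 = 0.
Proof. by rewrite /mass val_strict. Qed.

Lemma mass_le nu U V : bounded nu -> U `<=` V -> mass nu U <= mass nu V.
Proof. by move=> nub UV; rewrite -lee_fin -!massE//; exact: (val_scott nu).1. Qed.

Lemma mass_leT nu U : bounded nu -> mass nu U <= mass nu opensT.
Proof. by move=> nub; exact: mass_le. Qed.

Lemma mass_modular nu U V : bounded nu ->
  mass nu U + mass nu V = mass nu (opensU U V) + mass nu (opensI U V).
Proof. by move=> nub; apply/EFin_inj; rewrite !EFinD -!massE//; exact: val_modular. Qed.

Lemma massD nu mu U : bounded nu -> bounded mu ->
  mass (nu + mu) U = mass nu U + mass mu U.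
Proof. by move=> nub mub; rewrite {1}/mass /= (massE _ nub) (massE _ mub). Qed.

Lemma massZ (a : {nonneg R}) nu U : bounded nu -> mass (a *: nu) U = a%:num * mass nu U.
Proof. by move=> nub; rewrite {1}/mass /= (massE _ nub). Qed.

Lemma bounded_add nu mu : bounded nu -> bounded mu -> bounded (nu + mu).
Proof. by move=> nub mub; rewrite /bounded /= lte_add_pinfty. Qed.

Lemma bounded_scale (a : {nonneg R}) nu : bounded nu -> bounded (a *: nu).
Proof. by move=> nub; rewrite /bounded /= lte_mul_pinfty// lee_fin. Qed.

Lemma mass_ext nu mu : bounded nu -> bounded mu ->
  (forall U, mass nu U = mass mu U) -> nu = mu.
Proof. by move=> nub mub e; apply: valuation_ext => U; rewrite !massE// e. Qed.

Lemma mass_eq0 nu : bounded nu -> mass nu opensT = 0 -> nu = 0.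
Proof.
move=> nub nu0; apply: mass_ext => //; first by rewrite /bounded /= ltry.
move=> U; rewrite {2}/mass /=; apply/eqP.
by rewrite eq_le mass_ge0 andbT -nu0 mass_leT.
Qed.

End Mass.

Section Restriction.
Context {R : realType} {X : topologicalType}.
Implicit Types (nu mu : valuation R X) (U V : opens X).
Local Open Scope ereal_scope.

Program Definition val_restrict U nu : valuation R X :=
  @Valuation R X (fun V => nu (opensI U V)) _ _ _ _.
Next Obligation. by move=> U nu V; exact: val_ge0. Qed.
Next Obligation.
move=> U nu; rewrite /strict -(val_strict nu); congr (nu _).
by apply: opens_inj; exact: setI0.
Qed.
Next Obligation.
move=> U nu V W; rewrite val_modular; congr (nu _ + nu _); apply: opens_inj => /=.
  by rewrite setIUr.
by rewrite setIACA setIid.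
Qed.
Next Obligation.
move=> U nu; have [nuS nuD] := val_scott nu.
split=> [V W VW|D [[V0 DV0] dD]] /=; first by apply: nuS => x [Ux /VW].
have -> : opensI U (opens_bigcup D) = opens_bigcup (opensI U @` D).
  apply: opens_inj; apply/seteqP; split=> [x [Ux [V DV Vx]]|x [_ [V DV <-] [Ux Vx]]].
    by exists (opensI U V) => //; exists V.
  by split=> //; exists V.
rewrite nuD ?image_comp//; split; first by exists (opensI U V0), V0.
move=> _ _ [V DV <-] [W DW <-]; have [Z [DZ VZ WZ]] := dD _ _ DV DW.
by exists (opensI U Z); split; [exists Z|move=> x [Ux /VZ]|move=> x [Ux /WZ]].
Qed.

(** The part of nu carried by the complement of [U]. The complement is not open,
    so the value is obtained as a difference, which is where nu U < +oo enters. *)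
Program Definition val_corestrict U nu (nuU : nu U < +oo) : valuation R X :=
  @Valuation R X (fun V => nu (opensU U V) - nu U) _ _ _ _.
Next Obligation.
move=> U nu nuU V; rewrite leeBrDr ?ge0_fin_numE ?val_ge0// add0e.
by apply: (val_scott nu).1; exact: subsetUl.
Qed.
Next Obligation.
move=> U nu nuU; rewrite /strict (_ : opensU U opens0 = U).
  by rewrite subee ?ge0_fin_numE ?val_ge0.
by apply: opens_inj; exact: setU0.
Qed.
Next Obligation.
move=> U nu nuU V W; rewrite addeACA [RHS]addeACA; congr (_ + _).
rewrite val_modular; congr (nu _ + nu _); apply: opens_inj => /=.
  by rewrite setUACA setUid.
by rewrite setUIr.
Qed.
Next Obligation.
move=> U nu nuU; have [nuS nuD] := val_scott nu.
have Ufin : nu U \is a fin_num by rewrite ge0_fin_numE ?val_ge0.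
split=> [V W VW|D [[V0 DV0] dD]] /=.
  by rewrite leeD2r//; apply: nuS => x [Ux|/VW]; [left|right].
have -> : opensU U (opens_bigcup D) = opens_bigcup (opensU U @` D).
  apply: opens_inj; apply/seteqP; split=> [x [Ux|[V DV Vx]]|x [_ [V DV <-] [Ux|Vx]]].
  - by exists (opensU U V0); [exists V0|left].
  - by exists (opensU U V); [exists V|right].
  - by left.
  - by right; exists V.
rewrite nuD; last first.
  split; first by exists (opensU U V0), V0.
  move=> _ _ [V DV <-] [W DW <-]; have [Z [DZ VZ WZ]] := dD _ _ DV DW.
  exists (opensU U Z); split; first by exists Z.
    by move=> x [Ux|/VZ]; [left|right].
  by move=> x [Ux|/WZ]; [left|right].
apply/eqP; rewrite eq_le; apply/andP; split.
  rewrite leeBlDr//; apply: ge_ereal_sup => _ [_ [V DV <-] <-].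
  by rewrite -leeBlDr//; apply: ereal_sup_ubound; exists V.
apply: ge_ereal_sup => _ [V DV <-]; rewrite leeD2r//.
by apply: ereal_sup_ubound; exists (opensU U V) => //; exists V.
Qed.

Lemma val_restrict_split U nu (nuU : nu U < +oo) :
  nu = (val_restrict U nu + val_corestrict nuU)%R.
Proof.
apply: valuation_ext => V /=.
rewrite addeA (addeC (nu (opensI U V))) -val_modular addeAC.
by rewrite subee ?add0e ?ge0_fin_numE ?val_ge0.
Qed.

Lemma point_opens_subbase :
  is_subbase (range (fun x : X => [set U : opens X | opens_set U x]) :
    set (set (point_opens X))).
Proof. exact: open_from_subbase. Qed.

(** Whether x is in the intersection of [U] and V depends on V only through
    whether x is in V, and likewise for the union: hence restriction
    preserves point-continuity. *)
Lemma opensI_continuous U :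
  continuous (opensI U : point_opens X -> point_opens X).
Proof.
apply: subbase_continuous point_opens_subbase _ => _ [x _ <-].
have [Ux|Ux] := pselect (opens_set U x).
  apply: point_opens_subbase.1; exists x => //.
  by apply/seteqP; split=> V //= [].
rewrite (_ : _ @^-1` _ = set0); first exact: open0.
by apply/seteqP; split=> V //= [].
Qed.

Lemma opensU_continuous U :
  continuous (opensU U : point_opens X -> point_opens X).
Proof.
apply: subbase_continuous point_opens_subbase _ => _ [x _ <-].
have [Ux|Ux] := pselect (opens_set U x).
  rewrite (_ : _ @^-1` _ = setT); first exact: openT.
  by apply/seteqP; split=> V //= _; left.
apply: point_opens_subbase.1; exists x => //.
by apply/seteqP; split=> V /=; [right|case].
Qed.

Lemma point_continuous_restrict U nu : point_continuous nu ->
  point_continuous (val_restrict U nu).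
Proof.
move=> nup; apply/scott_continuousP => r.
exact: ((continuousP _).1 (@opensI_continuous U) _ ((scott_continuousP _).1 nup r)).
Qed.

Lemma point_continuous_corestrict U nu (nuU : nu U < +oo) : point_continuous nu ->
  point_continuous (val_corestrict nuU).
Proof.
move=> nup; have Ufin : nu U \is a fin_num by rewrite ge0_fin_numE ?val_ge0.
apply/scott_continuousP => r /=.
have onu := (scott_continuousP _).1 nup (r + nu U).
have := (continuousP _).1 (@opensU_continuous U) _ onu.
congr (open _); apply/seteqP; split=> V /=; by rewrite lteBrDr.
Qed.

(** [nu1] is concentrated on [U] and [nu2] on its complement. This is what the
    trimming argument needs to know about a class of valuations. *)
Definition splits_along_opens (S : set (valuation R X)) : Prop :=
  forall nu U, S nu -> exists nu1 nu2,
    [/\ S nu1, S nu2, nu = (nu1 + nu2)%R, nu1 U = nu1 opensT & nu2 U = 0].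

Lemma restrict_corestrict_bounded U nu (nub : bounded nu) (nuU : nu U < +oo) :
  [/\ bounded (val_restrict U nu), bounded (val_corestrict nuU),
   val_restrict U nu U = val_restrict U nu opensT & val_corestrict nuU U = 0].
Proof.
have Ufin : nu U \is a fin_num by rewrite ge0_fin_numE ?val_ge0.
split=> /=.
- rewrite /bounded /=; apply: le_lt_trans nub; exact: (val_scott nu).1.
- rewrite /bounded /= lteBlDr// addye ?gt_eqF ?ltNye_eq ?Ufin//.
  by apply: le_lt_trans nub; exact: (val_scott nu).1.
- by congr (nu _); apply: opens_inj; rewrite /= setIid setIT.
- rewrite (_ : opensU U U = U) ?subee//; apply: opens_inj; exact: setUid.
Qed.

Lemma bounded_splits : splits_along_opens (@bounded R X).
Proof.
move=> nu U nub.
have nuU : nu U < +oo by apply: le_lt_trans nub; exact: (val_scott nu).1.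
have [b1 b2 e1 e2] := restrict_corestrict_bounded nub nuU.
exists (val_restrict U nu), (val_corestrict nuU); split=> //.
exact: val_restrict_split.
Qed.

Lemma point_bounded_splits : splits_along_opens (@point_bounded R X).
Proof.
move=> nu U [nub nup].
have nuU : nu U < +oo by apply: le_lt_trans nub; exact: (val_scott nu).1.
have [b1 b2 e1 e2] := restrict_corestrict_bounded nub nuU.
exists (val_restrict U nu), (val_corestrict nuU); split=> //.
- by split=> //; exact: point_continuous_restrict.
- by split=> //; exact: point_continuous_corestrict.
- exact: val_restrict_split.
Qed.

End Restriction.

(** * Finite sublattices of opens *)

Section FiniteLattice.
Context {X : topologicalType}.

Definition is_sublattice (L : seq (opens X)) : Prop :=
  [/\ opens0 \in L, opensT \in L &
      forall U V, U \in L -> V \in L -> opensU U V \in L /\ opensI U V \in L].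

(** Adding one open U to a finite sublattice L: the opens (A & U) | B with A, B
    in L are closed under both operations, by distributivity. *)
Lemma generated_sublattice (Us : seq (opens X)) :
  exists2 L, is_sublattice L & {subset Us <= L}.
Proof.
elim: Us => [|U Us [L [L0 LT LUI] UsL]].
  exists [:: opens0; opensT] => //; split; rewrite ?inE ?eqxx ?orbT//.
  have in0T (W : opens X) : W \in [:: opens0; opensT] <-> W = opens0 \/ W = opensT.
    rewrite !inE; split=> [/orP[]/eqP->|[->|->]]; rewrite ?eqxx ?orbT//.
      by left.
    by right.
  move=> U V /in0T[->|->] /in0T[->|->]; split; apply/in0T;
    by [left; apply: opens_inj; rewrite /= ?setU0 ?setI0 ?set0I|
        right; apply: opens_inj; rewrite /= ?setTU ?setUT ?setIT].
pose g A B := opensU (opensI A U) B.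
have gL A B : A \in L -> B \in L -> g A B \in [seq g A B | A <- L, B <- L].
  by move=> AL BL; exact: allpairs_f.
exists [seq g A B | A <- L, B <- L]; first split.
- rewrite (_ : opens0 = g opens0 opens0) ?gL//.
  by apply: opens_inj; rewrite /= set0I setU0.
- rewrite (_ : opensT = g opens0 opensT) ?gL//.
  by apply: opens_inj; rewrite /= set0I set0U.
- move=> _ _ /allpairsP[[A B] [/= AL BL ->]] /allpairsP[[C D] [/= CL DL ->]]; split.
    rewrite (_ : opensU _ _ = g (opensU A C) (opensU B D)).
      by apply: gL; [exact: (LUI A C AL CL).1|exact: (LUI B D BL DL).1].
    by apply: opens_inj; rewrite /= setIUl setUACA.
  rewrite (_ : opensI _ _ =
    g (opensU (opensI A C) (opensU (opensI A D) (opensI B C))) (opensI B D)).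
    apply: gL; last exact: (LUI B D BL DL).2.
    apply: (LUI _ _ (LUI _ _ AL CL).2 _).1.
    exact: (LUI _ _ (LUI _ _ AL DL).2 (LUI _ _ BL CL).2).1.
  apply: opens_inj; apply/seteqP; split=> x /=; rewrite /setU /setI /=; tauto.
- move=> V; rewrite inE => /predU1P[->|/UsL VL].
    rewrite (_ : U = g opensT opens0) ?gL//.
    by apply: opens_inj; rewrite /= setTI setU0.
  rewrite (_ : V = g opens0 V) ?gL//.
  by apply: opens_inj; rewrite /= set0I set0U.
Qed.

End FiniteLattice.

Lemma seq_argmax (d : Order.disp_t) (T : orderType d) (I : eqType) (s : seq I)
    (f : I -> T) (i0 : I) :
  i0 \in s -> exists2 i, i \in s & forall j, j \in s -> (f j <= f i)%O.
Proof.
elim: s i0 => // a s ih i0 _; case: s ih => [_|b s ih].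
  by exists a; rewrite ?mem_head// => j; rewrite inE => /eqP->.
have [i is_ max_i] := ih b (mem_head _ _).
case: (leP (f a) (f i)) => [ai|/ltW ia].
  exists i; first by rewrite in_cons is_ orbT.
  by move=> j; rewrite in_cons => /predU1P[->//|]; exact: max_i.
exists a; first exact: mem_head.
by move=> j; rewrite in_cons => /predU1P[->//|/max_i ji]; exact: le_trans ia.
Qed.

(** * Trimming a valuation that dominates another one *)

Section Trimming.
Context {R : realType} {X : topologicalType}.
Implicit Types (nu mu kappa lambda : valuation R X) (U V : opens X).
Variable S : set (valuation R X).
Hypotheses (Sb : S `<=` @bounded R X)
  (SD : forall nu mu, S nu -> S mu -> S (nu + mu))
  (SZ : forall (a : {nonneg R}) nu, S nu -> S (a *: nu))
  (Ss : splits_along_opens S).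
Variables (L : seq (opens X)) (delta : valuation R X).
Hypotheses (sL : is_sublattice L) (deltab : bounded delta).

(** As far as [U] can tell, lambda lies in [U] or in its complement. *)
Definition concentrated lambda U : Prop :=
  mass lambda U = mass lambda opensT \/ mass lambda U = 0.

Lemma concentrated_summand lambda1 lambda2 U :
  bounded lambda1 -> bounded lambda2 ->
  concentrated (lambda1 + lambda2) U -> concentrated lambda1 U /\ concentrated lambda2 U.
Proof.
move=> b1 b2; rewrite /concentrated !massD//.
have := mass_leT U b1; have := mass_leT U b2.
have := mass_ge0 lambda1 U; have := mass_ge0 lambda2 U.
move=> ? ? ? ? [?|?]; split; by [left; lra|right; lra].
Qed.

Definition dominates kappa : Prop :=
  forall V, V \in L -> mass delta V <= mass kappa V.

(** On [L] the function kappa - delta is nonnegative and modular, so if it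
    vanishes at [T1] and [T2] it vanishes at their union. *)
Lemma tight_union kappa T1 T2 : bounded kappa -> dominates kappa ->
  T1 \in L -> T2 \in L ->
  mass delta T1 = mass kappa T1 -> mass delta T2 = mass kappa T2 ->
  mass delta (opensU T1 T2) = mass kappa (opensU T1 T2).
Proof.
move=> kb dk T1L T2L e1 e2; have [_ _ LUI] := sL.
have [UL IL] := LUI _ _ T1L T2L.
have := mass_modular T1 T2 deltab; have := mass_modular T1 T2 kb.
have := dk _ UL; have := dk _ IL; lra.
Qed.

(** A piece lambda that is concentrated with respect to every open of [L] is
    scaled down until the first constraint becomes tight. Only the constraints
    for opens that contain lambda are affected, so the binding one is the open
    of [L] with the largest deficit delta - kappa. *)
Lemma trim_concentrated kappa lambda : bounded kappa -> S lambda ->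
  (forall V, V \in L -> concentrated lambda V) -> dominates (kappa + lambda) ->
  exists lambda1 lambda2 T,
    [/\ S lambda1, S lambda2, lambda = lambda1 + lambda2, dominates (kappa + lambda1)
      & [/\ T \in L, mass delta T = mass (kappa + lambda1) T &
          mass lambda1 T = mass lambda1 opensT]].
Proof.
move=> kb Sl cl dkl; have lb := Sb Sl; have [L0 LT _] := sL.
have [V VL maxV] := seq_argmax (fun V => mass delta V - mass kappa V) L0.
have [dk0|dk0] := leP (mass delta V - mass kappa V) 0.
  exists (0 *: lambda), lambda, opens0; split=> //.
  - exact: SZ.
  - by rewrite scale0r add0r.
  - move=> W /maxV; rewrite scale0r addr0; lra.
  - by rewrite !mass0 !massZ// !mul0r.
(* The deficit at V is positive, so lambda charges V and is contained in it;
   the right scaling factor is the deficit divided by the mass of lambda. *)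
have mV : mass delta V - mass kappa V <= mass lambda V.
  by have := dkl _ VL; rewrite massD//; lra.
have mlV : mass lambda V = mass lambda opensT by case: (cl _ VL) => //; lra.
set m := mass lambda opensT in mlV; have m0 : 0 < m by lra.
set e := mass delta V - mass kappa V in mV dk0 maxV.
have t0 : 0 <= e / m by rewrite divr_ge0// ltW.
have t1 : 0 <= 1 - e / m by rewrite subr_ge0 ler_pdivrMr//; lra.
exists (NngNum t0 *: lambda), (NngNum t1 *: lambda), V; split=> //.
- exact: SZ.
- exact: SZ.
- rewrite -scalerDl (_ : _ + _ = 1) ?scale1r//.
  by apply/val_inj; rewrite /= addrC subrK.
- move=> W WL; rewrite massD ?massZ//; last exact: bounded_scale.
  have [->|l0] := cl _ WL; first by rewrite /= divfK ?gt_eqF//; have := maxV _ WL; lra.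
  by have := dkl _ WL; rewrite massD// l0; lra.
- rewrite massD ?massZ//; last exact: bounded_scale.
  by rewrite /= mlV divfK ?gt_eqF// /e; split=> //; lra.
Qed.

(** [Us] lists the opens along which lambda may still have to be cut. After
    splitting along its head, each half is trimmed while the other one is kept
    in the background kappa. Trimming the second half keeps the tight open [T1]
    of the first one tight: the value there can only decrease, and domination
    prevents that. *)
Lemma trim (Us : seq (opens X)) kappa lambda : bounded kappa -> S lambda ->
  (forall V, V \in L -> V \in Us \/ concentrated lambda V) ->
  dominates (kappa + lambda) ->
  exists lambda1 lambda2 T,
    [/\ S lambda1, S lambda2, lambda = lambda1 + lambda2, dominates (kappa + lambda1)
      & [/\ T \in L, mass delta T = mass (kappa + lambda1) T &
          mass lambda1 T = mass lambda1 opensT]].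
Proof.
elim: Us kappa lambda => [|U Us ih] kappa lambda kb Sl cl dkl.
  by apply: trim_concentrated => // V /cl[].
have [l1 [l2 [Sl1 Sl2 ll f1 f2]]] := Ss U Sl.
have b1 := Sb Sl1; have b2 := Sb Sl2.
(* Summands of a concentrated valuation are concentrated, so that cutting along
   U does not spoil the opens that have already been dealt with. *)
have cU V : V \in L ->
    (V \in Us \/ concentrated l1 V) /\ (V \in Us \/ concentrated l2 V).
  move=> /cl[|]; last first.
    by rewrite ll => /(concentrated_summand b1 b2)[]; split; right.
  rewrite inE => /predU1P[->|]; last by split; left.
  by split; right; [left|right]; rewrite /mass ?f1 ?f2.
have [||V /cU[]||m1 [n1 [T1 [Sm1 Sn1 e1 d1 [T1L t1 c1]]]]] := ih (kappa + l2) l1 => //.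
- exact: bounded_add.
- by rewrite -addrA (addrC l2) -ll.
have mb1 := Sb Sm1.
have [||V /cU[]||m2 [n2 [T2 [Sm2 Sn2 e2 d2 [T2L t2 c2]]]]] := ih (kappa + m1) l2 => //.
- exact: bounded_add.
- by rewrite addrAC.
have mb2 := Sb Sm2; have nb2 := Sb Sn2.
have kb1 := bounded_add kb mb1; have kb12 := bounded_add kb1 mb2.
have b2' := bounded_add mb2 nb2; have kb2 := bounded_add kb b2'.
exists (m1 + m2), (n1 + n2), (opensU T1 T2); split.
- exact: SD.
- exact: SD.
- by rewrite ll e1 e2 addrACA.
- by rewrite addrA.
rewrite addrA; have [_ _ LUI] := sL; split; first exact: (LUI _ _ T1L T2L).1.
- apply: tight_union => //.
  have := d2 _ T1L; have := mass_ge0 n2 T1; rewrite t1 e2 !massD//.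
  clear ll e1 e2 f1 f2; lra.
- have s1 : T1 `<=` opensU T1 T2 by left.
  have s2 : T2 `<=` opensU T1 T2 by right.
  have := mass_le mb1 s1; have := mass_le mb2 s2.
  have := mass_leT (opensU T1 T2) mb1; have := mass_leT (opensU T1 T2) mb2.
  move: c1 c2; rewrite !massD//; clear ll e1 e2 f1 f2; lra.
Qed.

(** All the mass of [nu1] sits in a tight open T, so
    nu1 X = nu1 T = delta T <= delta X, while domination at X gives the
    converse. This is a finite splitting lemma of max-flow type. *)
Lemma dominated_summand nu : S nu -> dominates nu ->
  exists nu1 nu2, [/\ S nu1, S nu2, nu = nu1 + nu2, dominates nu1 &
    mass nu1 opensT = mass delta opensT].
Proof.
move=> Snu dnu.
have b0 : @bounded R X 0 by rewrite /bounded /= ltry.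
have [V VL||nu1 [nu2 [T [S1 S2 e d [TL t c]]]]] := trim (Us := L) b0 Snu.
- by left.
- by rewrite add0r.
rewrite add0r in d t; exists nu1, nu2; split=> //.
have [_ LT _] := sL; have := d _ LT; have := mass_leT T deltab; lra.
Qed.

End Trimming.

(** * The weak topology *)

Section WeakTopology.
Context {R : realType} {X : topologicalType}.
Implicit Types (nu mu : valuation R X) (U V : opens X).

Lemma valuation_subbase : is_subbase ([set W | exists (U : opens X) (r : R),
    (0 < r)%R /\ W = [set nu : valuation R X | (r%:E < nu U)%E]] :
  set (set (valuation R X))).
Proof. exact: open_from_subbase. Qed.

(** The subbase only has thresholds r > 0; the threshold 0 is a union of
    those, and the negative ones give everything. *)
Lemma valuation_open_gt U (a : \bar R) : open [set nu : valuation R X | (a < nu U)%E].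
Proof.
have o_pos (r : R) : 0 < r -> open [set nu : valuation R X | (r%:E < nu U)%E].
  by move=> r0; apply: valuation_subbase.1; exists U, r.
case: a => [r| |].
- have [r0|r0] := ltP 0 r; first exact: o_pos.
  have [r_0|r_0] := eqVneq r 0; last first.
    rewrite (_ : [set _ | _] = setT); first exact: openT.
    apply/seteqP; split=> // nu _ /=; apply: lt_le_trans (val_ge0 nu U).
    by rewrite lte_fin lt_neqAle r_0.
  rewrite (_ : [set _ | _] = \bigcup_(s in [set s : R | 0 < s])
      [set nu : valuation R X | (s%:E < nu U)%E]).
    by apply: bigcup_open => s /= s0; exact: o_pos.
  rewrite r_0; apply/seteqP; split=> nu /=.
    case E : (nu U) => [y| |] // y0.
      exists (y / 2); rewrite /= ?E ?lte_fin ?divr_gt0//.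
      by rewrite ltr_pdivrMr// ltr_pMr// ltr1n.
    by exists 1 => //=; rewrite E ltry.
  by move=> [s /= s0]; apply: lt_trans; rewrite lte_fin.
- rewrite (_ : [set _ | _] = set0); first exact: open0.
  by apply/seteqP; split=> // nu /=; rewrite ltNge leey.
- rewrite (_ : [set _ | _] = setT); first exact: openT.
  by apply/seteqP; split=> // nu _ /=; exact: lt_le_trans (val_ge0 nu U).
Qed.

Lemma valuation_openP (W : set (valuation R X)) nu : open W -> W nu ->
  exists s : seq (opens X * R),
    (forall p, p \in s -> 0 < p.2 /\ (p.2%:E < nu p.1)%E) /\
    forall mu, (forall p, p \in s -> (p.2%:E < mu p.1)%E) -> W mu.
Proof.
move=> oW Wnu; have [s [sD sW]] := valuation_subbase.2 _ _ oW Wnu.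
suff [t [tnu ts]] : exists t : seq (opens X * R),
    (forall p, p \in t -> 0 < p.2 /\ (p.2%:E < nu p.1)%E) /\
    forall mu, (forall p, p \in t -> (p.2%:E < mu p.1)%E) ->
      forall A, A \in s -> A mu.
  by exists t; split=> // mu /ts; exact: sW.
elim: s sD {sW} => [|A s ih] sD; first by exists [::].
have [t [tnu ts]] := ih (fun C Cs => sD C (mem_behead (s := A :: s) Cs)).
have [[U [r [r0 AE]]] Anu] := sD _ (mem_head _ _).
exists ((U, r) :: t); split.
  move=> p; rewrite inE => /predU1P[->/=|/tnu//]; split=> //.
  by move: Anu; rewrite AE.
move=> mu tmu C; rewrite inE => /predU1P[->|].
  by rewrite AE; exact: (tmu _ (mem_head _ _)).
by apply: ts => p pt; apply: tmu; rewrite inE pt orbT.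
Qed.

Section InitialWeak.
Context {Y : topologicalType} (v : Y -> valuation R X).
Hypothesis v_open : forall O : set Y, open O <-> exists2 W, open W & v @^-1` W = O.

Lemma weak_initial_open_gt U (a : \bar R) : open [set y | (a < v y U)%E].
Proof.
apply/v_open; exists [set nu : valuation R X | (a < nu U)%E] => //.
exact: valuation_open_gt.
Qed.

Lemma weak_initial_continuous (T : topologicalType) (g : T -> Y) :
  (forall U (r : R), 0 < r -> open [set t | (r%:E < v (g t) U)%E]) ->
  continuous g.
Proof.
move=> og; have cg : continuous (v \o g).
  by apply: subbase_continuous valuation_subbase _ => _ [U [r [r0 ->]]]; exact: og.
apply/continuousP => _ /v_open[W oW <-].
exact: ((continuousP _).1 cg _ oW).
Qed.

End InitialWeak.

End WeakTopology.

(** * Cones of valuations with their normalized elements as a base *)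

Lemma bijective_inverse (A B : Type) (f : A -> B) : injective f ->
  (forall y, exists x, f x = y) -> exists g, cancel f g /\ cancel g f.
Proof.
move=> fI fS; have [g gK] := choice fS.
by exists g; split=> // x; apply: fI; rewrite gK.
Qed.

(** [M] and [B] are presented as the subspaces S and S /\ (nu X = 1) of the space
    of valuations through embeddings [vM] and [vB], so that the same proof serves
    for all bounded valuations and for the point-continuous ones. *)
Section ValuationConeWithBase.
Context {R : realType} {X : topologicalType} {M : topConeType R} {B : topConvType R}.
Variables (vM : M -> valuation R X) (vB : B -> valuation R X) (i : B -> convex_cone M).
Variable S : set (valuation R X).
Hypotheses (Sb : S `<=` @bounded R X) (Ss : splits_along_opens S).
Hypotheses (vM_inj : injective vM) (vMD : {morph vM : x y / x + y})
  (vMZ : forall a, {morph vM : x / a *: x})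
  (vM_range : range vM = S)
  (vM_open : forall O : set M, open O <-> exists2 W, open W & vM @^-1` W = O).
Hypotheses (vB_inj : injective vB)
  (vB_conv : forall (a : {i01 R}) x y,
     vB (x <| a |> y) = a%:num%:nng *: vB x + (1 - a%:num)%:nng *: vB y)
  (vB_range : range vB = S `&` @normalized R X)
  (vB_open : forall O : set B, open O <-> exists2 W, open W & vB @^-1` W = O).
Hypothesis vi : forall b, vM (i b) = vB b.

Lemma vM_S x : S (vM x).
Proof. by rewrite -vM_range; exists x. Qed.
Lemma vB_S b : S (vB b).
Proof. by have := imageT vB b; rewrite vB_range => -[]. Qed.
Lemma vB_normalized b : normalized (vB b).
Proof. by have := imageT vB b; rewrite vB_range => -[]. Qed.

Lemma S_add nu mu : S nu -> S mu -> S (nu + mu).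
Proof. by rewrite -vM_range => -[x _ <-] [y _ <-]; exists (x + y); rewrite ?vMD. Qed.
Lemma S_scale (a : {nonneg R}) nu : S nu -> S (a *: nu).
Proof. by rewrite -vM_range => -[x _ <-]; exists (a *: x); rewrite ?vMZ. Qed.

Lemma incl_continuous : continuous (i : B -> M).
Proof.
apply: (weak_initial_continuous vM_open) => U r _.
rewrite (_ : [set _ | _] = [set b | (r%:E < vB b U)%E]).
  exact: (weak_initial_open_gt vB_open).
by apply/seteqP; split=> b /=; rewrite vi.
Qed.

Lemma incl_affine : affine i.
Proof. by move=> a x y; apply: vM_inj; rewrite vi vB_conv convex_coneE vMD !vMZ !vi. Qed.

Lemma valuation_cone_semitopological : semitopological_cone M.
Proof.
split; last split.
- move=> y; apply: (weak_initial_continuous vM_open) => U r r0.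
  have yfin : vM y U \is a fin_num by rewrite (massE _ (Sb (vM_S y))).
  rewrite (_ : [set _ | _] = [set x | (r%:E - vM y U < vM x U)%E]).
    exact: (weak_initial_open_gt vM_open).
  by apply/seteqP; split=> x /=; rewrite vMD /= lteBlDr.
- move=> a; have [->|a0] := eqVneq a 0.
    rewrite (_ : (fun x : M => _) = cst 0); first exact: cst_continuous.
    by apply/funext => x; rewrite scale0r.
  have {}a0 : 0 < a%:num by rewrite lt0r ge0 andbT.
  apply: (weak_initial_continuous vM_open) => U r r0.
  rewrite (_ : [set _ | _] = [set x | ((a%:num^-1)%:E * r%:E < vM x U)%E]).
    exact: (weak_initial_open_gt vM_open).
  by apply/seteqP; split=> x /=; rewrite vMZ /= lte_pdivrMl.
- move=> x; apply: (weak_initial_continuous vM_open) => U r r0.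
  have xE := massE U (Sb (vM_S x)).
  have m0 := mass_ge0 (vM x) U.
  have [m_0|m_0] := eqVneq (mass (vM x) U) 0.
    rewrite (_ : [set _ | _] = set0); first exact: open0.
    apply/seteqP; split=> a //=; rewrite vMZ /= xE m_0 mule0 lte_fin.
    by move=> /(lt_trans r0); rewrite ltxx.
  have {}m0 : 0 < mass (vM x) U by rewrite lt_neqAle eq_sym m_0.
  have rm0 : 0 <= r / mass (vM x) U by rewrite divr_ge0// ltW.
  apply: (scott_subbase _).1; exists (NngNum rm0) => //.
  apply/seteqP; split=> a /=; rewrite -num_lt vMZ /= xE -EFinM lte_fin ltr_pdivrMr//.
Qed.

Lemma normalized_semitopological_bary : semitopological_bary B.
Proof.
have [addc [scalec _]] := valuation_cone_semitopological.
have combination_continuous (c : {nonneg R}) (z : M) :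
    continuous (fun x : B => c *: (i x : M) + z).
  move=> x; apply: (@continuous_comp B M M (fun x => c *: (i x : M)) (fun z' => z' + z));
    last exact: addc.
  by apply: (@continuous_comp B M M i ( *:%R c)); [exact: incl_continuous|exact: scalec].
have cl (a : {i01 R}) (y : B) : continuous (fun x : B => x <| a |> y).
  have ch : continuous (fun x => i (x <| a |> y) : M).
    have -> : (fun x => i (x <| a |> y) : M) =
        (fun x => a%:num%:nng *: (i x : M) + (1 - a%:num)%:nng *: (i y : M)).
      by apply/funext => x; exact: incl_affine.
    exact: combination_continuous.
  apply: (weak_initial_continuous vB_open) => U r _.
  have -> : [set x | (r%:E < vB (x <| a |> y) U)%E] =
      (fun x => i (x <| a |> y) : M) @^-1` [set z | (r%:E < vM z U)%E].
    by apply/seteqP; split=> x; rewrite /= vi.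
  exact: ((continuousP _).1 ch _ (weak_initial_open_gt vM_open _ _)).
split=> //; split.
  move=> a x; have -> : (fun y => x <| a |> y) = (fun y => y <| (1 - a%:num)%:i01 |> x).
    by apply/funext => y; rewrite convC.
  exact: cl.
move=> x y; apply: (weak_initial_continuous vB_open) => U r r0.
pose g (t : R^o) : R^o := t * mass (vB x) U + (1 - t) * mass (vB y) U.
have cg : continuous g.
  move=> t; apply: cvgD; (apply: cvgM; last exact: cvg_cst); first exact: cvg_id.
  by apply: cvgB; [exact: cvg_cst|exact: cvg_id].
rewrite (_ : [set _ | _] =
    (fun a : unit_itv R => (a : {i01 R})%:num : R^o) @^-1` (g @^-1` [set t | r < t])).
  apply: ((continuousP _).1 (@initial_continuous _ _ _)).
  by apply: ((continuousP _).1 cg); exact: open_gt.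
apply/seteqP; split=> a; rewrite /= vB_conv /= (massE U (Sb (vB_S x)));
  by rewrite (massE U (Sb (vB_S y))) -!EFinM -EFinD lte_fin.
Qed.

Let phi : cone B -> M := cone_lift i.

Lemma mass_vB b : mass (vB b) opensT = 1.
Proof. by rewrite /mass vB_normalized. Qed.

Lemma vphi (r : {posnum R}) (b : B) : vM (phi (Some (r, b))) = r%:num%:nng *: vB b.
Proof. by rewrite /= vMZ vi. Qed.

Lemma normalize_range nu (q : {posnum R}) : S nu -> mass nu opensT = q%:num ->
  exists b, nu = q%:num%:nng *: vB b.
Proof.
move=> Snu nuq; have c0 : 0 <= q%:num^-1 by [].
pose c := NngNum c0; pose nu1 := c *: nu.
have : range vB nu1.
  rewrite vB_range; split; first exact: S_scale.
  by rewrite /normalized /= (massE _ (Sb Snu)) nuq -EFinM mulVf.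
move=> [b _ bE]; exists b; rewrite bE /nu1 scalerA (_ : _ * _ = 1) ?scale1r//.
by apply/val_inj; rewrite /= mulfV.
Qed.

Lemma cone_lift_incl_inj : injective phi.
Proof.
have mphi r b : mass (vM (phi (Some (r, b)))) opensT = r%:num.
  by rewrite vphi massZ ?mass_vB ?mulr1//; apply: Sb; exact: vB_S.
have m0 : mass (vM 0) opensT = 0.
  by rewrite -(scale0r (0 : M)) vMZ massZ; [exact: mul0r|exact/Sb/vM_S].
move=> [[r b]|] [[s c]|] //= e.
- have rs : r = s by apply/val_inj; rewrite /= -(mphi r b) -(mphi s c) /= e.
  subst s; congr (Some (_, _)); apply: vB_inj; rewrite -!vi; congr vM.
  have a0 : 0 <= r%:num^-1 by [].
  pose a := NngNum a0.
  have rK : a * r%:num%:nng = 1 by apply/val_inj; rewrite /= mulVf.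
  by rewrite -[LHS]scale1r -[RHS]scale1r -rK -!scalerA e.
- have := mphi r b; rewrite /= e m0 => /esym/eqP; rewrite gt_eqF//.
- have := mphi s c; rewrite /= -e m0 => /esym/eqP; rewrite gt_eqF//.
Qed.

Lemma cone_lift_incl_surj x : exists u, phi u = x.
Proof.
have [m0|m0] := eqVneq (mass (vM x) opensT) 0.
  exists 0; apply: vM_inj; rewrite (mass_eq0 (Sb (vM_S x)) m0) /=.
  by rewrite -[LHS]/(vM 0) -(scale0r (0 : M)) vMZ scale0r.
have {}m0 : 0 < mass (vM x) opensT by rewrite lt_neqAle eq_sym m0 mass_ge0.
have [b bE] := normalize_range (q := PosNum m0) (vM_S x) erefl.
by exists (Some (PosNum m0, b)); apply: vM_inj; rewrite vphi -bE.
Qed.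

(** Here the trimming argument is used: near [x0] every x has a summand of mass
    exactly [q] that dominates [q] *: mu0 on finitely many opens, and the open
    sets of the cone are stable under adding the other summand. *)
Lemma cone_lift_incl_inv_continuous (psi : M -> cone B) :
  cancel phi psi -> cancel psi phi -> continuous psi.
Proof.
move=> phiK psiK.
apply: subbase_continuous (@cone_subbase_is_subbase R B) _ => A [A0 oA Aup].
rewrite openE => x0 /= Ax0.
case E : (psi x0) Ax0 => [[r0 b0]|//] Ax0.
move: oA; rewrite openE => /(_ (r0, b0) Ax0) [[N1 N2] /= [nN1 nN2] NA].
have [q qr N1q] : exists2 q : {posnum R}, q%:num < r0%:num & N1 q.
  have : @nbhs _ (scott {posnum R}) r0 N1 by [].
  rewrite nbhsE => -[O [oO Or0] ON1].
  have [OT|[a]] := scott_openP oO Or0.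
    exists (r0%:num / 2)%:pos; last by apply: ON1; rewrite OT.
    by rewrite /= ltr_pdivrMr// ltr_pMr// ltr1n.
  rewrite -num_lt => ar aO; exists ((a%:num + r0%:num) / 2)%:pos.
    by rewrite /= midf_lt.
  by apply: ON1; apply: aO; rewrite -num_lt /= midf_lt.
have [s [s0 sN2]] : exists s : seq (opens X * R),
    (forall p, p \in s -> 0 < p.2 /\ (p.2%:E < vB b0 p.1)%E) /\
    forall b, (forall p, p \in s -> (p.2%:E < vB b p.1)%E) -> N2 b.
  move: nN2; rewrite nbhsE => -[O [/vB_open[W oW <-] Wb0] ON2].
  have [s [s0 sW]] := valuation_openP oW Wb0.
  by exists s; split=> // b sb; apply: ON2; exact: sW.
have [L sL sub_L] := generated_sublattice (map fst s).
(* Since q < r0, the inequality delta V < vM x0 V is strict where it is not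
   trivial, so it persists near x0. *)
have q0 : 0 <= q%:num by [].
pose delta := NngNum q0 *: vB b0.
have b0b := Sb (vB_S b0).
have deltab : bounded delta by exact: bounded_scale.
have x0E : vM x0 = r0%:num%:nng *: vB b0 by rewrite -(psiK x0) E vphi.
have : \forall x \near x0, forall V, V \in L -> mass delta V <= mass (vM x) V.
  apply: near_all => V _.
  have [m0|m0] := eqVneq (mass (vB b0) V) 0.
    by apply: nearW => x; rewrite massZ// m0 mulr0 mass_ge0.
  have {}m0 : 0 < mass (vB b0) V by rewrite lt_neqAle eq_sym m0 mass_ge0.
  have : \forall x \near x0, ((mass delta V)%:E < vM x V)%E.
    apply: open_nbhs_nbhs; split; first exact: (weak_initial_open_gt vM_open).
    by rewrite /= x0E massE ?lte_fin ?massZ//= ?ltr_pM2r//; exact: bounded_scale.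
  apply: filterS => x; rewrite (massE _ (Sb (vM_S x))) lte_fin; exact: ltW.
apply: filterS => x dx.
have [nu1 [nu2 [S1 S2 xE d1 m1]]] :=
  dominated_summand Sb S_add S_scale Ss sL deltab (vM_S x) dx.
have [b bE] : exists b, nu1 = q%:num%:nng *: vB b.
  by apply: normalize_range => //; rewrite m1 massZ// mass_vB mulr1.
have [y _ yE] : range vM nu2 by rewrite vM_range.
rewrite /preimage /=; have -> : psi x = (Some (q, b) : cone B) + psi y.
  apply: (can_inj phiK).
  rewrite psiK /phi (cone_lift_semilinear incl_affine).2 -/phi psiK.
  by apply: vM_inj; rewrite vMD vphi yE xE bE.
apply: (Aup (Some (q, b))); last first.
  apply: (NA (q, b)); split=> //=; apply: sN2 => p ps.
  have [p0 pb0] := s0 _ ps.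
  have := d1 p.1 (sub_L _ (map_f fst ps)).
  rewrite bE !massZ ?b0b//=; last by apply: Sb; exact: vB_S.
  rewrite ler_pM2l// -lee_fin -!massE//; last by apply: Sb; exact: vB_S.
  exact: lt_le_trans.
by right; case: (psi y) => [[t c]|]; do 2!eexists; (split; first by reflexivity);
  [exists (Some (t, c))|exists None]; eexists; (split; first by reflexivity).
Qed.

Lemma valuation_cone_iso :
  [/\ affine i, continuous i, semitopological_cone M, semitopological_bary B &
    exists psi : M -> cone B,
      [/\ cancel (cone_lift i) psi, cancel psi (cone_lift i) & continuous psi]].
Proof.
split; [exact: incl_affine|exact: incl_continuous|exact: valuation_cone_semitopological|
  exact: normalized_semitopological_bary|].
have [psi [phiK psiK]] := bijective_inverse cone_lift_incl_inj cone_lift_incl_surj.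
by exists psi; split=> //; exact: cone_lift_incl_inv_continuous.
Qed.

End ValuationConeWithBase.

(** * Bounded and point-continuous bounded valuations *)

Section Instances.
Context {R : realType} {X : topologicalType}.

Lemma set_type_range (T : Type) (A : set T) : range (@sval T (fun x => x \in A)) = A.
Proof.
apply/seteqP; split=> [_ [[x xA] _ <-]|x Ax]; first exact: set_mem.
by exists (exist _ x (mem_set Ax)).
Qed.

Lemma V1_Vb_iso (i := @V1_incl R X : V1 R X -> convex_cone (Vb R X)) :
  [/\ affine i, continuous i, semitopological_cone (Vb R X),
      semitopological_bary (V1 R X) &
    exists psi : Vb R X -> cone (V1 R X),
      [/\ cancel (cone_lift i) psi, cancel psi (cone_lift i) & continuous psi]].
Proof.
apply: (@valuation_cone_iso _ _ _ _
  (\val : Vb R X -> _) (\val : V1 R X -> _) i (@bounded R X)) => //.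
- exact: bounded_splits.
- exact: set_type_range.
- by rewrite (setIidr (@normalized_bounded R X)); exact: set_type_range.
Qed.

Lemma V1p_Vbp_iso (i := @V1p_incl R X : V1p R X -> convex_cone (Vbp R X)) :
  [/\ affine i, continuous i, semitopological_cone (Vbp R X),
      semitopological_bary (V1p R X) &
    exists psi : Vbp R X -> cone (V1p R X),
      [/\ cancel (cone_lift i) psi, cancel psi (cone_lift i) & continuous psi]].
Proof.
apply: (@valuation_cone_iso _ _ _ _
  (\val : Vbp R X -> _) (\val : V1p R X -> _) i (@point_bounded R X)) => //.
- by move=> nu [].
- exact: point_bounded_splits.
- exact: set_type_range.
- rewrite [LHS]set_type_range; apply/seteqP; split=> nu.
    by move=> [nu1 nup]; split=> //; split=> //; exact: normalized_bounded.
  by move=> [[_ nup] nu1].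
Qed.

End Instances.

Theorem theorem3p27 (R : realType) (X : topologicalType) :
  [/\ free_cone (@V1_incl R X),
      free_semitopological_cone (@V1_incl R X),
      (forall (C : topConeType R) (f : V1 R X -> convex_cone C)
          (g : {linear Vb R X -> C}),
        semitopological_cone C -> affine f -> continuous f ->
        extends (@V1_incl R X) f g -> continuous g),
      (exists phi : {linear cone (V1 R X) -> Vb R X},
        [/\ semitopological_cone_iso phi,
            extends (@cone_unit R (V1 R X)) (@V1_incl R X) phi &
            forall (Y : topologicalType) (h : continuousType X Y)
                (psi : {linear cone (V1 R Y) -> Vb R Y}),
              extends (@cone_unit R (V1 R Y)) (@V1_incl R Y) psi ->
              forall u : cone (V1 R X),
                psi (cone_map (V1_map h) u) = Vb_map h (phi u)]) &
      free_semitopological_cone (@V1p_incl R X)].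
Proof.
have [ai ci sM sB [inv [phiK invK cinv]]] := @V1_Vb_iso R X.
have [aip cip sMp sBp [invp [phipK invpK cinvp]]] := @V1p_Vbp_iso R X.
split.
- exact: free_cone_of_iso phiK invK.
- exact: free_semitopological_of_iso cinv _ _ _.
- move=> C f g sC af cf gf.
  exact: (extension_continuous ai phiK invK cinv sC af cf gf).
- exists (cone_lift_linear ai); split; first exact: (cone_iso_of_iso ai phiK invK).
    exact: cone_lift_unit.
  move=> Y h psi psiE u; rewrite (cone_lift_uniq psiE).
  by apply/val_inj/valuation_ext => U; case: u => [[r nu]|].
- exact: free_semitopological_of_iso cinvp _ _ _.
Qed.
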